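(* Suppose $f\in\mathbb L^2(\mathbb S^1)$ and Assumption (A) holds: there is $\sigma_0>0$ with $\sigma(x)\ge\sigma_0$ for all $x\in\mathbb S^1$. Let $m\in\mathcal M_n$ and $\hat f=\frac{(\hat\psi_m)_+}{\hat\sigma\vee n^{-1/2}}$. Then \[\mathbb E\big(\|\hat f-f\|_2^2\big)\le\frac{8}{\sigma_0^2}\Big(\|\psi-\psi_m\|_2^2+\frac{\Phi_0^2D_m\,\mathbb E(\Delta_1)}{n}\Big)+\frac{C}{n},\] where $\psi_m$ is the orthogonal projection of $\psi$ on $S_m$ and $C$ is a constant depending on $\Phi_0,\sigma_0$ and $\|f\|_2$.
   Context: Identify $\mathbb S^1$ with $[0,2\pi)$ with its order and anticlockwise orientation; for $x,y\in\mathbb S^1$, the arc $[x,y]$ is the usual interval if $x\le y$ and $[x,2\pi)\cup[0,y]$ if $x>y$. $\mathbb L^2(\mathbb S^1)$ carries $\langle g,h\rangle=\int_{\mathbb S^1}gh$, norm $\|\cdot\|_2$. Let $(X,L,U)$ be $\mathbb S^1$-valued, $X$ independent of $(L,U)$, $X$ with density $f$, $L\neq U$ a.s.; $(X_i,L_i,U_i)_{i\le n}$ are i.i.d. copies. Set $\Delta_i=\mathbb 1_{\{X_i\in[L_i,U_i]\}}$, $X_i'=X_i$ if $\Delta_i=1$ and $X_i'=-\pi$ otherwise. Define $\sigma(x)=\mathbb P(x\in[L,U])$, $\psi=f\sigma$, $\hat\sigma(x)=\frac1n\sum_{i=1}^n\mathbb 1_{\{x\in[L_i,U_i]\}}$.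 A collection of linear sieves $(S_m)_{m\in\mathcal M_n}$ consists of finite-dimensional subspaces of $\mathbb L^2(\mathbb S^1)$ with $\dim S_m=D_m\le n$ and a constant $\Phi_0>0$ such that $\|t\|_\infty\le\Phi_0\sqrt{D_m}\|t\|_2$ for all $m$ and $t\in S_m$ (equivalently $\|\sum_{\lambda\in\Lambda_m}\varphi_\lambda^2\|_\infty\le\Phi_0^2D_m$ for an orthonormal basis $(\varphi_\lambda)_{\lambda\in\Lambda_m}$ of $S_m$). The estimator is $\hat\psi_m=\sum_{\lambda\in\Lambda_m}\big(\frac1n\sum_{i=1}^n\Delta_i\varphi_\lambda(X_i')\big)\varphi_\lambda$. $a\vee b=\max(a,b)$ and $h_+=\max(h,0)$. *)

(* Defs.v *)
From HB Require Import structures.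
From mathcomp Require Import all_boot all_order all_algebra.
From mathcomp Require Import all_classical all_reals all_analysis.
Set Implicit Arguments. Unset Strict Implicit. Unset Printing Implicit Defensive.
Import Order.TTheory GRing.Theory Num.Theory.
Local Open Scope classical_set_scope.
Local Open Scope ring_scope.

Section CircleDefs.
Context {R : realType}.

(* S^1 identified with [0, 2 pi) *)
Definition circle : set R := [set x | 0 <= x /\ x < 2 * pi].

(* membership of z in the (anticlockwise) arc [x, y] of S^1 *)
Definition arcb (x y z : R) : bool :=
  if x <= y then (x <= z) && (z <= y)
  else ((x <= z) && (z < 2 * pi)) || ((0 <= z) && (z <= y)).

Definition l2dot (g h : R -> R) : \bar R :=
  (\int[@lebesgue_measure R]_(x in circle) (g x * h x)%:E)%E.
Definition l2sq (g : R -> R) : \bar R :=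
  (\int[@lebesgue_measure R]_(x in circle) ((g x) ^+ 2)%:E)%E.

(* orthogonal projection on span of an orthonormal family phi *)
Definition l2proj (D : nat) (phi : 'I_D -> R -> R) (g : R -> R) (x : R) : R :=
  \sum_(l < D) fine (l2dot g (phi l)) * phi l x.

Definition orthonormal_fam (D : nat) (phi : 'I_D -> R -> R) : Prop :=
  (forall l, measurable_fun circle (phi l)) /\
  (forall l l', l2dot (phi l) (phi l') = ((l == l')%:R)%:E).

Context {d : measure_display} {Omega : measurableType d}.

Definition sigmaf (P : probability Omega R) (L U : Omega -> R) (x : R) : R :=
  fine (P [set w | arcb (L w) (U w) x]).

Variable n : nat.
Variables (Xs Ls Us : 'I_n -> Omega -> R).

Definition Delta (i : 'I_n) (w : Omega) : R :=
  (arcb (Ls i w) (Us i w) (Xs i w))%:R.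

Definition Xprime (i : 'I_n) (w : Omega) : R :=
  if arcb (Ls i w) (Us i w) (Xs i w) then Xs i w else - pi.

Definition sigma_hat (w : Omega) (x : R) : R :=
  n%:R^-1 * \sum_(i < n) (arcb (Ls i w) (Us i w) x)%:R.

Definition psi_hat (D : nat) (phi : 'I_D -> R -> R) (w : Omega) (x : R) : R :=
  \sum_(l < D)
     (n%:R^-1 * \sum_(i < n) Delta i w * phi l (Xprime i w)) * phi l x.

Definition f_hat (D : nat) (phi : 'I_D -> R -> R) (w : Omega) (x : R) : R :=
  Num.max (psi_hat phi w x) 0 / Num.max (sigma_hat w x) (Num.sqrt n%:R)^-1.

End CircleDefs.

(* Main.v *)
Require Import Defs.
From HB Require Import structures.
From mathcomp Require Import all_boot all_order all_algebra.
From mathcomp Require Import all_classical all_reals all_analysis.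
From mathcomp Require Import measurable_realfun ring lra.
Import Order.TTheory GRing.Theory Num.Theory.
Import numFieldNormedType.Exports.
Local Open Scope classical_set_scope.
Local Open Scope ring_scope.
Set Implicit Arguments.
Unset Strict Implicit.
Unset Printing Implicit Defensive.

(** Write psi = f sigma. At a point x where sigma_hat(x) >= sigma0/2, the error
    (f_hat - f)^2 is at most 8/sigma0^2 times
    (psi_hat - psi)^2 + f^2 (max(sigma_hat, n^-1/2) - sigma)^2, because f >= 0
    almost everywhere makes taking the positive part of psi_hat harmless. The
    first term is handled by Pythagoras in L^2 and the variance of the empirical
    coefficients; the second has expectation O(f^2/n). Where
    sigma_hat(x) < sigma0/2, the crude bound f_hat^2 <= Phi0^4 n^3 suffices,
    since by a Chernoff bound this event has probability O(exp(-c n)), hence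
    O(n^-4). Only pointwise control of sigma_hat is needed: Tonelli's theorem
    exchanges the expectation and the integral over the circle. *)

(** The floor n^(-1/2) in the denominator balances two needs. Its square is 1/n, the order of the
    variance of [sigma_hat], so it costs nothing more at good points; its inverse square is only n,
    so a bad point costs a polynomial factor, which the exponential tail absorbs. The factor 8 is
    the 2 of (a - b)^2 <= 2 a^2 + 2 b^2 times the 4 of (sigma0 / 2)^(-2). Much of the work lies in
    the form of the hypotheses. Independence and equality of laws are given on boxes, whereas the
    event that an observation lies on its arc couples all three coordinates; both properties must be
    carried to the whole product sigma-algebra. The density is given through integrals over sets, so
    its sign and the formula for the expectation of h(X) have to be derived. *)

Definition image_measure (d1 d2 : measure_display) (T1 : measurableType d1)
    (T2 : measurableType d2) (R : realType) (m : {measure set T1 -> \bar R})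
    (f : T1 -> T2) (mf : measurable_fun setT f) : {measure set T2 -> \bar R}.
Proof. by refine (pushforward m f : {measure set T2 -> \bar R}). Defined.

Lemma image_measureE (d1 d2 : measure_display) (T1 : measurableType d1)
    (T2 : measurableType d2) (R : realType) (m : {measure set T1 -> \bar R})
    (f : T1 -> T2) (mf : measurable_fun setT f) A :
  image_measure m mf A = m (f @^-1` A).
Proof. by []. Qed.

(** * Uniqueness of finite measures on products *)

Section measure_uniqueness.
Context {R : realType}.
Local Open Scope ereal_scope.

(** Rectangles form a pi-system that generates the product sigma-algebra and contains the whole
    space; as [m1] is finite, the constant sequence [setT] serves as exhaustion. *)
Lemma rectangle_measure_unique (d1 d2 : measure_display)
    (T1 : measurableType d1) (T2 : measurableType d2)
    (m1 m2 : {measure set (T1 * T2) -> \bar R}) :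
  m1 setT < +oo ->
  (forall A B, measurable A -> measurable B -> m1 (A `*` B) = m2 (A `*` B)) ->
  forall C, measurable C -> m1 C = m2 C.
Proof.
move=> m1oo m12.
pose G : set (set (T1 * T2)) :=
  [set A `*` B | A in measurable & B in measurable].
have GT : G setT by exists setT => //; exists setT => //; rewrite setXTT.
have GI : setI_closed G.
  move=> _ _ [A1 mA1 [B1 mB1 <-]] [A2 mA2 [B2 mB2 <-]].
  exists (A1 `&` A2); first exact: measurableI.
  by exists (B1 `&` B2); [exact: measurableI|rewrite setXI].
apply: (measure_unique G (fun=> setT)) => //.
- by rewrite measurable_prod_measurableType.
- by rewrite bigcup_const.
- by move=> _ [A mA [B mB <-]]; exact: m12.
Qed.

(** Uniqueness on rectangles is used twice: for fixed [A], restricting to the cylinder over [A] and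
    projecting turns the measure of [A] times [C] into a measure in [C] on the last two
    coordinates. *)
Lemma box_measure_unique (d1 d2 d3 : measure_display)
    (T1 : measurableType d1) (T2 : measurableType d2) (T3 : measurableType d3)
    (m1 m2 : {measure set (T1 * (T2 * T3)) -> \bar R}) :
  m1 setT < +oo ->
  (forall A B C, measurable A -> measurable B -> measurable C ->
    m1 (A `*` (B `*` C)) = m2 (A `*` (B `*` C))) ->
  forall E, measurable E -> m1 E = m2 E.
Proof.
move=> m1oo m12; apply: rectangle_measure_unique => // A B mA.
have mAT : measurable (A `*` [set: T2 * T3]) by exact: measurableX.
pose n1 := image_measure (mrestr m1 mAT) measurable_snd.
pose n2 := image_measure (mrestr m2 mAT) measurable_snd.
have E (C : set (T2 * T3)) : snd @^-1` C `&` (A `*` setT) = A `*` C.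
  by apply/seteqP; split=> -[x y] /=; [case=> ? []|case].
have n1E C : n1 C = m1 (A `*` C) by rewrite -E.
have n2E C : n2 C = m2 (A `*` C) by rewrite -E.
move=> mB; rewrite -n1E -n2E.
apply: rectangle_measure_unique mB => [|B' C' mB mC].
  rewrite n1E.
  by apply: le_lt_trans m1oo; apply: le_measure => //; rewrite inE.
by rewrite n1E n2E m12.
Qed.

End measure_uniqueness.

(** * Independence: from generating sets to all measurable sets *)

Section independence.
Context {R : realType} {d : measure_display} {Omega : measurableType d}.
Variable P : probability Omega R.

Lemma measurable_forall_ord (n : nat) (Q : pred 'I_n) (A : 'I_n -> set Omega) :
  (forall i, measurable (A i)) ->
  measurable [set w | forall i, Q i -> A i w].
Proof.
move=> mA; rewrite (_ : mkset _ = \bigcap_(i in [set` Q]) A i).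
  by apply: fin_bigcap_measurable => // i _; exact: mA.
by apply/seteqP; split=> w /= H i; exact: H.
Qed.

(* The sets of G are replaced by arbitrary measurable ones one coordinate at a
   time, each step being a uniqueness argument for two finite measures. *)
Lemma independence_extend (dE : measure_display) (E : measurableType dE)
    (G : set (set E)) (n : nat) (T : 'I_n -> Omega -> E) :
  G `<=` measurable ->
  (forall m1 m2 : {measure set E -> \bar R}, (m1 setT < +oo)%E ->
     (forall A, G A -> m1 A = m2 A) ->
     forall A, measurable A -> m1 A = m2 A) ->
  (forall i, measurable_fun setT (T i)) ->
  (forall B : 'I_n -> set E, (forall i, G (B i)) ->
     P [set w | forall i, B i (T i w)] =
     (\prod_(i < n) P [set w | B i (T i w)])%E) ->
  forall B : 'I_n -> set E, (forall i, measurable (B i)) ->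
     P [set w | forall i, B i (T i w)] =
     (\prod_(i < n) P [set w | B i (T i w)])%E.
Proof.
move=> Gm GU mT indep B mB.
have mTB i (A : set E) : measurable A -> measurable [set w | A (T i w)].
  by move=> mA; rewrite -[X in measurable X]setTI; exact: mT.
(* Coordinates of index below [k] carry arbitrary measurable sets, the others still sets of [G]:
   [k = 0] is the hypothesis and [k = n] the claim. *)
suff H k : forall B : 'I_n -> set E, (forall i, measurable (B i)) ->
    (forall i : 'I_n, (k <= i)%N -> G (B i)) ->
    P [set w | forall i, B i (T i w)] =
    (\prod_(i < n) P [set w | B i (T i w)])%E.
  by apply: (H n) => // i; rewrite leqNgt ltn_ord.
elim: k => [|k IHk] {mB}B mB GB; first by apply: indep => i; exact: GB.
have [kn|nk] := ltnP k n; last first.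
  by apply: IHk => // i ki; have := leq_trans nk ki; rewrite leqNgt ltn_ord.
pose i0 := Ordinal kn.
pose F := [set w | forall i, i != i0 -> B i (T i w)].
have mF : measurable F by apply: measurable_forall_ord => i; exact: mTB.
pose c := (\prod_(i < n | i != i0) P [set w | B i (T i w)])%E.
have c0 : (0 <= c)%E by rewrite /c; apply: prode_ge0.
have cfin : c \is a fin_num.
  by apply: prode_fin_num => i _; exact: fin_num_measure (mTB _ _ (mB i)).
have fc0 : (0 <= fine c)%R by exact: fine_ge0.
(* Both sides of the product formula are finite measures in the set at coordinate [i0]: the law of
   [T i0] on the event [F], and the law of [T i0] scaled by the product [c] of the other factors. *)
pose m1 := image_measure (mrestr P mF) (mT i0).
pose m2 : {measure set E -> \bar R} :=
  mscale (NngNum fc0) (image_measure P (mT i0)).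
pose B' C i := if i == i0 then C else B i.
have m1E C : m1 C = P [set w | forall i, B' C i (T i w)].
  rewrite /m1 image_measureE /mrestr; congr (P _).
  apply/seteqP; split=> w /=.
    by move=> [Cw Fw] i; rewrite /B'; case: eqVneq => [->//|]; exact: Fw.
  move=> H; split; first by have := H i0; rewrite /B' eqxx.
  by move=> i ii0; have := H i; rewrite /B' (negbTE ii0).
have m2E C : m2 C = (\prod_(i < n) P [set w | B' C i (T i w)])%E.
  rewrite (bigD1 i0)//= /B' eqxx [RHS]muleC.
  rewrite (eq_bigr (fun i => P [set w | B i (T i w)])); last first.
    by move=> i /negbTE ->.
  by rewrite -/c /m2 /mscale /= fineK.
have Bi0 : B' (B i0) = B.
  by apply/funext => i; rewrite /B'; case: eqVneq => // ->.
rewrite -{1}Bi0 -m1E (GU m1 m2)// ?m2E ?Bi0//.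
- apply: (@le_lt_trans _ _ (P setT)); last by rewrite probability_setT ltry.
  rewrite m1E; apply: le_measure; rewrite ?inE//.
  have := @measurable_forall_ord n predT (fun i w => B' setT i (T i w)).
  move=> /(_ _)/= H; rewrite (_ : mkset _ = [set w | forall i, true -> B' setT i (T i w)]).
    by apply: H => i; apply: mTB; rewrite /B'; case: ifP.
  by apply/seteqP; split => w /= K i; [move=> _|]; exact: K.
move=> C GC; rewrite m1E m2E; apply: IHk => i.
  by rewrite /B'; case: ifP => // _; exact: Gm.
rewrite leq_eqVlt => /orP[/eqP ki|ki].
  by rewrite /B' (_ : i = i0) ?eqxx//; exact: val_inj.
rewrite /B'; case: eqVneq => // _; exact: GB.
Qed.

Lemma independence_pair (dE : measure_display) (E : measurableType dE)
    (n : nat) (T : 'I_n -> Omega -> E) :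
  (forall B : 'I_n -> set E, (forall i, measurable (B i)) ->
     P [set w | forall i, B i (T i w)] =
     (\prod_(i < n) P [set w | B i (T i w)])%E) ->
  forall i j, i != j -> forall A B, measurable A -> measurable B ->
    P [set w | A (T i w) /\ B (T j w)] =
    (P [set w | A (T i w)] * P [set w | B (T j w)])%E.
Proof.
move=> indep i j ij A B mA mB.
pose C k := if k == i then A else if k == j then B else setT.
have := indep C; rewrite (_ : mkset _ = [set w | A (T i w) /\ B (T j w)]).
  move=> ->; last by move=> k; rewrite /C; do 2 case: ifP => // _.
  rewrite (bigD1 i)//= (bigD1 j)/=; last by rewrite eq_sym.
  rewrite big1 ?mule1; last first.
    move=> k /andP[/negbTE ki /negbTE kj]; rewrite /C ki kj.
    by rewrite (_ : mkset _ = setT) ?probability_setT//; apply/seteqP.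
  by rewrite /C eqxx eq_sym (negbTE ij) eqxx.
apply/seteqP; split=> w /=.
  move=> H; split; first by have := H i; rewrite /C eqxx.
  by have := H j; rewrite /C eqxx eq_sym (negbTE ij).
by move=> [Aw Bw] k; rewrite /C; do 2 case: eqVneq => [->//|_].
Qed.

End independence.

Lemma bounded_integrable (R : realType) (d : measure_display)
    (T : measurableType d) (mu : {measure set T -> \bar R}) (f : T -> R) (M : R) :
  (mu setT < +oo)%E ->
  measurable_fun setT f -> (forall w, `|f w| <= M) ->
  mu.-integrable setT (EFin \o f).
Proof.
move=> muoo mf fM; apply: measurable_bounded_integrable => //.
exists M; split; first exact: num_real.
by move=> x Mx w _; apply: (le_trans (fM w)); exact: ltW.
Qed.

Lemma probability_lty (R : realType) (d : measure_display)
    (T : measurableType d) (P : probability T R) : (P setT < +oo)%E.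
Proof. by rewrite probability_setT ltry. Qed.

(** * Fubini's theorem for independent variables *)

Section fubini_independence.
Context {R : realType} {d : measure_display} {Omega : measurableType d}.
Variable P : probability Omega R.

(* The law of (T1, T2) is compared with the image of P \x P, which avoids the
   product of the two image measures. *)
Lemma independence_fubini (d1 d2 : measure_display) (E1 : measurableType d1)
    (E2 : measurableType d2) (T1 : Omega -> E1) (T2 : Omega -> E2)
    (h : E1 * E2 -> R) (M : R) :
  measurable_fun setT T1 -> measurable_fun setT T2 ->
  (forall A B, measurable A -> measurable B ->
    P [set w | A (T1 w) /\ B (T2 w)] =
    (P [set w | A (T1 w)] * P [set w | B (T2 w)])%E) ->
  measurable_fun setT h -> (forall p, `|h p| <= M) ->
  (\int[P]_w (h (T1 w, T2 w))%:E = \int[P]_w \int[P]_v (h (T1 w, T2 v))%:E)%E.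
Proof.
move=> mT1 mT2 indep mh hM.
have mT : measurable_fun setT (fun w => (T1 w, T2 w)) by exact: measurable_fun_pair.
have mTT : measurable_fun setT (fun p : Omega * Omega => (T1 p.1, T2 p.2)).
  by apply: measurable_fun_pair; apply: measurableT_comp.
have E C : measurable C -> image_measure P mT C = image_measure (P \x P)%E mTT C.
  apply: rectangle_measure_unique.
    exact: probability_lty.
  move=> A B mA mB; rewrite [LHS]indep//.
  rewrite image_measureE.
  rewrite (_ : _ @^-1` _ = [set w | A (T1 w)] `*` [set w | B (T2 w)])//.
  rewrite [RHS](product_measure1E P P)//.
    by rewrite -[X in measurable X]setTI; exact: mT1.
  by rewrite -[X in measurable X]setTI; exact: mT2.
have mEh : measurable_fun [set: E1 * E2] (fun p => (h p)%:E) by exact/measurable_EFinP.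
have iPP : (P \x P)%E.-integrable [set: Omega * Omega] (fun p => (h (T1 p.1, T2 p.2))%:E).
  apply: (@bounded_integrable _ _ _ (P \x P)%E _ M) => //.
    rewrite -setXTT [ltLHS](product_measure1E P P)//.
    by apply: lte_mul_pinfty => //; [exact: fin_num_measure|exact: probability_lty].
  exact: measurableT_comp.
transitivity (\int[image_measure P mT]_p (h p)%:E)%E.
  rewrite (integral_pushforward mT)//.
  apply: (@bounded_integrable _ _ _ P _ M) => //.
    exact: probability_lty.
  exact: measurableT_comp.
rewrite (eq_measure_integral (image_measure (P \x P)%E mTT)); last first.
  by move=> A mA _; exact: E.
rewrite [LHS](integral_pushforward mTT)//.
by rewrite -integral12_prod_meas1.
Qed.

End fubini_independence.

Lemma measurable_bool_set (d : measure_display) (T : measurableType d)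
    (b : T -> bool) : measurable_fun setT b -> measurable [set w | b w].
Proof. by move=> mb; have := mb measurableT [set true] I; rewrite setTI. Qed.

Section bounded_Rintegral.
Context {R : realType} {d : measure_display} {Omega : measurableType d}.
Variable P : probability Omega R.

Lemma bounded_integrableP (f : Omega -> R) (M : R) :
  measurable_fun setT f -> (forall w, `|f w| <= M) ->
  P.-integrable setT (EFin \o f).
Proof. by move=> mf; apply: bounded_integrable => //; exact: probability_lty. Qed.

Lemma EFin_Rintegral (f : Omega -> R) : P.-integrable setT (EFin \o f) ->
  (\int[P]_w f w)%:E = (\int[P]_w (f w)%:E)%E.
Proof. by move=> fi; rewrite fineK//; exact: integrable_fin_num. Qed.

Lemma Rintegral_sum (I : finType) (F : I -> Omega -> R) :
  (forall i, P.-integrable setT (EFin \o F i)) ->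
  \int[P]_w (\sum_i F i w) = \sum_i \int[P]_w F i w.
Proof.
move=> iF; rewrite /Rintegral.
under eq_integral do rewrite -sumEFin.
rewrite integral_sum//= sum_fine// => i _.
by apply: integrable_fin_num => //; exact: iF.
Qed.

Lemma Rintegral_const (k : R) : \int[P]_w k = k.
Proof. by rewrite Rintegral_cst//= probability_setT/= mulr1. Qed.

End bounded_Rintegral.

(** * Equality of laws and expectations *)

Section identically_distributed.
Context {R : realType} {d : measure_display} {Omega : measurableType d}.
Variable P : probability Omega R.
Context {dE : measure_display} {E : measurableType dE}.

Lemma ident_Rintegral (S T : Omega -> E) (g : E -> R) (M : R) :
  measurable_fun setT S -> measurable_fun setT T ->
  (forall B, measurable B -> P [set w | B (S w)] = P [set w | B (T w)]) ->
  measurable_fun setT g -> (forall e, `|g e| <= M) ->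
  \int[P]_w g (S w) = \int[P]_w g (T w).
Proof.
move=> mS mT ST mg gM; congr fine.
have mEg : measurable_fun setT (EFin \o g) by exact/measurable_EFinP.
have H (V : Omega -> E) (mV : measurable_fun setT V) :
    (\int[image_measure P mV]_e (g e)%:E = \int[P]_w (g (V w))%:E)%E.
  rewrite (integral_pushforward mV)//.
  by apply: (@bounded_integrableP _ _ _ P _ (M)) => //; exact: measurableT_comp.
rewrite -(H _ mS) -(H _ mT); apply: eq_measure_integral => A mA _; exact: ST.
Qed.

End identically_distributed.

(** * Empirical means: mean squared error and lower tail *)

Section iid_sample.
Context {R : realType} {d : measure_display} {Omega : measurableType d}.
Variable P : probability Omega R.
Context {dE : measure_display} {E : measurableType dE}.
Variables (n : nat) (T : 'I_n -> Omega -> E) (T0 : Omega -> E).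
Hypothesis n0 : (0 < n)%N.
Hypothesis mT : forall i, measurable_fun setT (T i).
Hypothesis mT0 : measurable_fun setT T0.
Hypothesis ident : forall i B, measurable B ->
  P [set w | B (T i w)] = P [set w | B (T0 w)].
Hypothesis indep : forall B : 'I_n -> set E, (forall i, measurable (B i)) ->
     P [set w | forall i, B i (T i w)] =
     (\prod_(i < n) P [set w | B i (T i w)])%E.

(** After centring, independence kills the cross terms of the double sum and n diagonal terms
    remain. The raw second moment replaces the variance: for the coefficients of [psi_hat] it is
    what produces the factor E(Delta). *)
Lemma sample_mean_sq_error (g : E -> R) (M : R) :
  measurable_fun setT g -> (forall e, `|g e| <= M) ->
  \int[P]_w (n%:R^-1 * \sum_(i < n) g (T i w) - \int[P]_v g (T0 v)) ^+ 2 <=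
  n%:R^-1 * \int[P]_w (g (T0 w)) ^+ 2.
Proof.
move=> mg gM; set a := \int[P]_v g (T0 v).
have nR0 : (n%:R : R) != 0 by rewrite pnatr_eq0 -lt0n.
pose h e := g e - a.
have mh : measurable_fun setT h by exact: measurable_funB.
have hM e : `|h e| <= M + `|a|.
  by apply: (le_trans (ler_normB _ _)); rewrite lerD2r.
have K0 : 0 <= M + `|a|.
  by rewrite addr_ge0//; have := gM (T0 point); apply: le_trans.
have intT (V : Omega -> E) (k : E -> R) K : measurable_fun setT V ->
    measurable_fun setT k -> (forall e, `|k e| <= K) ->
    P.-integrable setT (EFin \o (fun w => k (V w))).
  move=> mV mk kK; apply: (@bounded_integrableP _ _ _ P _ (K)) => //.
  exact: measurableT_comp.
have Eh i : \int[P]_w h (T i w) = 0.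
  rewrite (ident_Rintegral _ _ (@ident i) mh hM)//.
  rewrite RintegralB//.
  - by rewrite Rintegral_const subrr.
  - exact: (intT T0 g M).
  - exact: (@bounded_integrableP _ _ _ P _ (`|a|)).
have hh i j : P.-integrable setT (EFin \o (fun w => h (T i w) * h (T j w))).
  apply: (@bounded_integrableP _ _ _ P _ ((M + `|a|) * (M + `|a|))).
    by apply: measurable_funM; exact: measurableT_comp.
  by move=> w; rewrite normrM ler_pM.
have cross i j : i != j -> \int[P]_w (h (T i w) * h (T j w)) = 0.
  move=> ij; rewrite /Rintegral.
  have := @independence_fubini _ _ _ P _ _ _ _ (T i) (T j)
    (fun p => h p.1 * h p.2) ((M + `|a|) * (M + `|a|)) (mT i) (mT j)
    (independence_pair indep ij).
  move=> /= ->; last 2 first.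
  - by apply: measurable_funM; exact: measurableT_comp.
  - by move=> p; rewrite normrM ler_pM.
  under eq_integral => w _.
    rewrite -EFin_Rintegral; last first.
      apply: (intT (T j) (fun e => h (T i w) * h e) ((M + `|a|) * (M + `|a|))) => //.
        exact: measurable_funM.
      by move=> e; rewrite normrM ler_pM.
    rewrite RintegralZl//; last exact: (intT _ _ _ _ mh hM).
    rewrite Eh mulr0.
    over.
  by rewrite integral0.
(* Here E h^2 = E g^2 - a^2, and the square of the mean is dropped. *)
have diag i : \int[P]_w (h (T i w) * h (T i w)) <= \int[P]_w (g (T0 w)) ^+ 2.
  rewrite (@ident_Rintegral _ _ _ P _ _ _ _ (fun e => h e * h e)
    ((M + `|a|) * (M + `|a|)) (mT i) mT0)//; last 3 first.
  - exact: ident.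
  - exact: measurable_funM.
  - by move=> e; rewrite normrM ler_pM.
  have ig2 : P.-integrable setT (EFin \o (fun w => (g (T0 w)) ^+ 2)).
    apply: (intT T0 (fun e => g e ^+ 2) (M ^+ 2)) => //.
      exact: measurable_funX.
    by move=> e; rewrite normrX ler_pXn2r// nnegrE// (le_trans _ (gM e)).
  have ig : P.-integrable setT (EFin \o (fun w => (2 * a) * g (T0 w))).
    apply: (intT T0 (fun e => 2 * a * g e) (`|2 * a| * M)) => //.
      exact: measurable_funM.
    by move=> e; rewrite normrM ler_wpM2l.
  have ic k : P.-integrable setT (EFin \o (fun=> k)).
    exact: (@bounded_integrableP _ _ _ P _ (`|k|)).
  rewrite (_ : (fun w => _) = (fun w => g (T0 w) ^+ 2 - 2 * a * g (T0 w) + a ^+ 2)); last first.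
    by apply/funext => w; rewrite /h; ring.
  rewrite RintegralD//; last by apply: (integrableB _ ig2 ig).
  rewrite RintegralB// RintegralZl//; last exact: (intT T0 g M).
  rewrite -/a Rintegral_const.
  by rewrite -[leRHS]addr0 -addrA lerD2l; have := sqr_ge0 a; lra.
rewrite (_ : (fun w => _) = (fun w => n%:R^-1 ^+ 2 *
   \sum_(p : 'I_n * 'I_n) h (T p.1 w) * h (T p.2 w))); last first.
  apply/funext => w.
  rewrite -(pair_bigA _ (fun i j => h (T i w) * h (T j w)))/=.
  rewrite -big_distrlr/= -expr2 -exprMn; congr (_ ^+ 2).
  rewrite /h sumrB sumr_const card_ord mulrBr; congr (_ - _).
  by rewrite -[a *+ n]mulr_natl mulrA mulVf// mul1r.
have isum : P.-integrable setT (EFin \o (fun w =>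
    \sum_(p : 'I_n * 'I_n) h (T p.1 w) * h (T p.2 w))).
  rewrite (_ : _ \o _ = (fun w => \sum_(p : 'I_n * 'I_n) (h (T p.1 w) * h (T p.2 w))%:E)%E).
    by apply: integrable_sum => //= p _; exact: hh.
  by apply/funext => w /=; rewrite sumEFin.
rewrite RintegralZl// Rintegral_sum//.
rewrite expr2 -mulrA ler_pM2l ?invr_gt0 ?ltr0n//.
rewrite -(pair_bigA _ (fun i j => \int[P]_w (h (T i w) * h (T j w))))/=.
rewrite ler_pdivrMl ?ltr0n//.
rewrite [leRHS]mulr_natl -[X in _ *+ X]card_ord -sumr_const.
apply: ler_sum => i _; rewrite (bigD1 i)//= big1 ?addr0//.
by move=> j ji; apply: cross; rewrite eq_sym.
Qed.

(* The factor 1 - 1_B / 2 is 2 ^ (- 1_B): this is a moment generating function. *)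
Lemma Rintegral_prod_half (B : set E) : measurable B ->
  \int[P]_w (\prod_(i < n) (1 - \1_B (T i w) / 2)) =
  (1 - fine (P [set w | B (T0 w)]) / 2) ^+ n.
Proof.
move=> mB; set p := fine _.
pose c (b : bool) : R := if b then 2^-1 else 1.
pose BB (b : bool) := if b then B else ~` B.
have mBB b : measurable (BB b) by case: b => //=; exact: measurableC.
have mTB i (A : set E) : measurable A -> measurable [set w | A (T i w)].
  by move=> mA; rewrite -[X in measurable X]setTI; exact: mT.
have mT0B (A : set E) : measurable A -> measurable [set w | A (T0 w)].
  by move=> mA; rewrite -[X in measurable X]setTI; exact: mT0.
pose q b := fine (P [set w | BB b (T0 w)]).
have qE : q false = 1 - p.
  rewrite /q /= (_ : mkset _ = ~` [set w | B (T0 w)])//.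
  by rewrite probability_setC ?fineB ?fin_num_measure//; exact: mT0B.
pose A (h : {ffun 'I_n -> bool}) := [set w | forall i, BB (h i) (T i w)].
have mA h : measurable (A h).
  rewrite (_ : A h = [set w | forall i, true -> BB (h i) (T i w)]).
    by apply: (@measurable_forall_ord _ _ _ predT (fun i w => BB (h i) (T i w))) => i; exact: mTB.
  by apply/seteqP; split=> w /= H i; [move=> _|]; exact: H.
(* The product is expanded over the patterns [h] recording which [T i] lie in [B]; exactly one
   pattern survives at each [w]. Independence gives the probability of a pattern, and the same
   distributivity later folds the sum back into a power. *)
rewrite (_ : (fun w => _) = (fun w => \sum_(h : {ffun 'I_n -> bool})
    (\prod_(i < n) c (h i)) * \1_(A h) w)); last first.
  apply/funext => w.
  rewrite (eq_bigr (fun i => \sum_(b : bool) c b * \1_(BB b) (T i w))).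
    rewrite bigA_distr_bigA/=; apply: eq_bigr => h _.
    rewrite big_split/=; congr (_ * _).
    rewrite indicE; have [|] := boolP (w \in A h).
      rewrite inE => Aw; rewrite big1// => i _.
      by rewrite indicE mem_set.
    move=> /negP Aw; apply/eqP; rewrite prodf_seq_eq0.
    apply/hasP; apply: contrapT => H; apply: Aw; rewrite inE => i.
    apply: contrapT => Bi; apply: H; exists i; first exact: mem_index_enum.
    by rewrite /= indicE memNset.
  move=> i _; rewrite big_bool/= !indicE in_setC.
  by case: (T i w \in B); rewrite /=; lra.
have PA h : P (A h) = (\prod_(i < n) P [set w | BB (h i) (T i w)])%E.
  exact: (indep (fun i => mBB (h i))).
have iA h : P.-integrable setT (EFin \o \1_(A h)).
  by apply: integrable_indic => //; exact: probability_lty.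
rewrite Rintegral_sum; last first.
  move=> h; apply: (@bounded_integrableP _ _ _ P _ (`|\prod_(i < n) c (h i)|)).
    by apply: measurable_funM => //; exact: measurable_indic.
  by move=> w; rewrite normrM ler_piMr// indicE; case: (_ \in _); rewrite ?normr1 ?normr0.
have IA h : \int[P]_w \1_(A h) w = \prod_(i < n) q (h i).
  rewrite /Rintegral integral_indic// setIT [X in fine X]PA.
  rewrite (eq_bigr (fun i => (q (h i))%:E)); last first.
    by move=> i _; rewrite ident// fineK// fin_num_measure//; exact: mT0B.
  by rewrite prodEFin.
under eq_bigr do rewrite RintegralZl// IA -big_split/=.
rewrite -(bigA_distr_bigA (fun i b => c b * q b))/=.
rewrite prodr_const card_ord big_bool/= qE; congr (_ ^+ _).
by rewrite /q /= -/p; lra.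
Qed.

(** Markov's inequality for 2^(-S), where S counts the hits of [B]. Base 2 optimises the resulting
    exponential bound for a threshold at half of [s], whence the rate s/2 (1 - ln 2). *)
Lemma sample_frequency_chernoff (B : set E) (s : R) : measurable B ->
  0 <= s -> (s%:E <= P [set w | B (T0 w)])%E ->
  (P [set w | (n%:R^-1 * \sum_(i < n) \1_B (T i w) < s / 2)%R] <=
   (expR (- (s / 2 * (1 - ln 2)) * n%:R))%:E)%E.
Proof.
move=> mB s0 sP.
have mT0B : measurable [set w | B (T0 w)].
  by rewrite -[X in measurable X]setTI; exact: mT0.
have mS : measurable_fun setT (fun w => \sum_(i < n) (\1_B (T i w) : R)).
  by apply: measurable_sum => i; apply: measurableT_comp => //; exact: measurable_indic.
have mbad : measurable [set w | (n%:R^-1 * \sum_(i < n) \1_B (T i w) < s / 2)%R].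
  apply: measurable_bool_set; apply: measurable_fun_ltr => //.
  exact: measurable_funM.
(* This is 2^(s n / 2): on the bad event S < s n / 2, so [k] times 2^(-S) is at least 1 there. *)
pose k := expR (ln 2 * (s / 2 * n%:R)).
have mprod : measurable_fun setT (fun w => \prod_(i < n) (1 - \1_B (T i w) / 2 : R)).
  apply: measurable_prod => i _; apply: measurable_funB => //.
  apply: measurable_funM => //.
  by apply: measurableT_comp => //; exact: measurable_indic.
have prod01 w : 0 <= \prod_(i < n) (1 - \1_B (T i w) / 2 : R) <= 1.
  have H i : 0 <= 1 - (\1_B (T i w) : R) / 2 <= 1.
    by rewrite indicE; case: (_ \in _) => /=; lra.
  apply/andP; split; first by apply: prodr_ge0 => i _; case/andP: (H i).
  have := @ler_prod R 'I_n (index_enum _) predT (fun i => 1 - \1_B (T i w) / 2) (fun=> 1).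
  by rewrite big1_eq; apply=> i _; exact: H.
have iprod : P.-integrable setT (EFin \o (fun w => \prod_(i < n) (1 - \1_B (T i w) / 2 : R))).
  apply: (@bounded_integrableP _ _ _ P _ 1) => // w.
  by have /andP[? ?] := prod01 w; rewrite ger0_norm.
apply: (@le_trans _ _ (\int[P]_w (k * \prod_(i < n) (1 - \1_B (T i w) / 2))%:E)%E).
  rewrite -[X in P X]setIT -integral_indic//; apply: ge0_le_integral => //.
  - by apply/measurable_EFinP; exact: measurable_indic.
  - by apply/measurable_EFinP; exact: measurable_funM.
  move=> w _; rewrite lee_fin indicE.
  have [|_] := boolP (w \in _); last first.
    by rewrite mulr_ge0 ?expR_ge0//; have /andP[] := prod01 w.
  rewrite inE /= => bad.
  rewrite (eq_bigr (fun i => expR (- ln 2 * \1_B (T i w)))); last first.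
    move=> i _; rewrite indicE; case: (_ \in _) => /=.
      by rewrite mulr1 expRN lnK ?posrE//; lra.
    by rewrite mulr0 expR0; lra.
  rewrite -expR_sum -expRD -mulr_sumr.
  rewrite -[X in X <= _]expR0 ler_expR mulNr -mulrBr mulr_ge0 ?ln_ge0//; first lra.
  move: bad; rewrite ltr_pdivrMl ?ltr0n// => /ltW; lra.
rewrite -EFin_Rintegral; last first.
  apply: (@bounded_integrableP _ _ _ P _ k); first exact: measurable_funM.
  move=> w; have /andP[? ?] := prod01 w.
  by rewrite normrM !ger0_norm ?expR_ge0// ler_piMr ?expR_ge0.
rewrite RintegralZl// Rintegral_prod_half// lee_fin.
set p := fine _.
have sp : s <= p by rewrite -lee_fin fineK ?fin_num_measure.
have p1 : p <= 1 by rewrite -lee_fin fineK ?fin_num_measure// probability_le1.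
(* Uses 1 - p/2 <= 1 - s/2 <= exp(-s/2). *)
apply: (@le_trans _ _ (k * expR (- (s / 2)) ^+ n)).
  rewrite ler_wpM2l ?expR_ge0// lerXn2r ?nnegrE ?expR_ge0//; first lra.
  apply: le_trans (expR_ge1Dx _); lra.
rewrite -expRM_natr /k -expRD ler_expR; lra.
Qed.

End iid_sample.

(** * Square-integrable functions on the circle *)

Section circle_L2.
Context {R : realType}.
Local Notation mu := (@lebesgue_measure R).

(* Lebesgue measure lives on [measurableTypeR R], whose measurable sets are
   convertible to those of [R] but whose display is different. *)
Local Notation TR := (measurableTypeR R).

Lemma circle_itv : @circle R = `[0, 2 * pi[%classic.
Proof.
apply/seteqP; split=> x /=; rewrite in_itv/=; first by move=> [-> ->].
by move=> /andP[].
Qed.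

Lemma measurable_circle : measurable (@circle R : set TR).
Proof. by rewrite circle_itv. Qed.

Lemma lebesgue_measure_circle : mu (@circle R) = (2 * pi)%:E.
Proof.
rewrite circle_itv lebesgue_measure_itv/= lte_fin.
by rewrite mulr_gt0 ?pi_gt0// sube0.
Qed.

Definition square_integrable (g : R -> R) :=
  measurable_fun (circle : set TR) g /\ (l2sq g < +oo)%E.

Lemma square_integrable_sqr (g : R -> R) : square_integrable g ->
  mu.-integrable circle (fun x => (g x ^+ 2)%:E).
Proof.
move=> [mg goo]; apply/integrableP; split.
  by apply/measurable_EFinP; exact: measurable_funX.
apply: le_lt_trans goo; rewrite le_eqVlt; apply/orP; left; apply/eqP.
by apply: eq_integral => x _; rewrite gee0_abs// lee_fin sqr_ge0.
Qed.

Lemma square_integrableM (g h : R -> R) : square_integrable g ->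
  square_integrable h -> mu.-integrable circle (EFin \o (fun x => g x * h x)).
Proof.
move=> sg sh.
have i2 := integrableD measurable_circle (square_integrable_sqr sg)
  (square_integrable_sqr sh).
apply: (le_integrable measurable_circle _ _ i2).
  by apply/measurable_EFinP; apply: measurable_funM; [exact: sg.1|exact: sh.1].
move=> x _; rewrite /= lee_fin [leRHS]ger0_norm ?addr_ge0 ?sqr_ge0//.
rewrite normrM -(real_normK (num_real (g x))) -(real_normK (num_real (h x))).
have := sqr_ge0 (`|g x| - `|h x|).
have := mulr_ge0 (normr_ge0 (g x)) (normr_ge0 (h x)).
nra.
Qed.

Lemma square_integrableD (g h : R -> R) : square_integrable g ->
  square_integrable h -> square_integrable (fun x => g x + h x).
Proof.
move=> sg sh; split; first exact: measurable_funD sg.1 sh.1.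
have := integrable_lty measurable_circle (integrableD measurable_circle
  (integrableD measurable_circle (square_integrable_sqr sg)
     (square_integrable_sqr sh))
  (integrableZl measurable_circle 2 (square_integrableM sg sh))).
rewrite /l2sq; congr (_ < _)%E; apply: eq_integral => x _ /=.
by rewrite -EFinM -!EFinD; congr EFin; ring.
Qed.

Lemma square_integrableZ (k : R) (g : R -> R) : square_integrable g ->
  square_integrable (fun x => k * g x).
Proof.
move=> sg; split; first by apply: measurable_funM => //; exact: sg.1.
have := integrable_lty measurable_circle
  (integrableZl measurable_circle (k ^+ 2) (square_integrable_sqr sg)).
rewrite /l2sq; congr (_ < _)%E; apply: eq_integral => x _ /=.
by rewrite -EFinM exprMn.
Qed.

Lemma square_integrable_sum (D : nat) (b : 'I_D -> R) (phi : 'I_D -> R -> R) :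
  (forall l, square_integrable (phi l)) ->
  square_integrable (fun x => \sum_(l < D) b l * phi l x).
Proof.
move=> sphi; elim: D b phi sphi => [|D IH] b phi sphi.
  under eq_fun do rewrite big_ord0.
  split; first exact: measurable_cst.
  by rewrite /l2sq; under eq_integral do rewrite expr0n/=; rewrite integral0.
under eq_fun do rewrite big_ord_recr/=.
apply: square_integrableD; last exact: square_integrableZ.
exact: (IH (fun i => b (widen_ord (leqnSn D) i)) (fun i => phi (widen_ord (leqnSn D) i))).
Qed.

Definition dot (g h : R -> R) : R := fine (l2dot g h).

Lemma dotC (g h : R -> R) : dot g h = dot h g.
Proof. by rewrite /dot /l2dot; under eq_integral do rewrite mulrC. Qed.

Lemma dotDl (g1 g2 h : R -> R) : square_integrable g1 ->
  square_integrable g2 -> square_integrable h ->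
  dot (fun x => g1 x + g2 x) h = dot g1 h + dot g2 h.
Proof.
move=> s1 s2 sh; rewrite /dot /l2dot.
have := RintegralD measurable_circle (square_integrableM s1 sh)
  (square_integrableM s2 sh).
by move=> <-; congr fine; apply: eq_integral => x _; rewrite mulrDl.
Qed.

Lemma dotZl (k : R) (g h : R -> R) : square_integrable g ->
  square_integrable h -> dot (fun x => k * g x) h = k * dot g h.
Proof.
move=> sg sh; rewrite /dot /l2dot.
have := RintegralZl k measurable_circle (square_integrableM sg sh).
by move=> <-; congr fine; apply: eq_integral => x _; rewrite -mulrA.
Qed.

Lemma dot_suml (D : nat) (b : 'I_D -> R) (phi : 'I_D -> R -> R) (h : R -> R) :
  (forall l, square_integrable (phi l)) -> square_integrable h ->
  dot (fun x => \sum_(l < D) b l * phi l x) h = \sum_(l < D) b l * dot (phi l) h.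
Proof.
move=> sphi sh; elim: D b phi sphi => [|D IH] b phi sphi.
  rewrite big_ord0 /dot /l2dot.
  by under eq_integral do rewrite big_ord0 mul0r; rewrite integral0.
under [X in dot X h]eq_fun do rewrite big_ord_recr/=.
rewrite dotDl//; last 2 first.
- exact: square_integrable_sum.
- exact: square_integrableZ.
by rewrite dotZl// IH// big_ord_recr.
Qed.

Lemma l2sq_dot (g : R -> R) : square_integrable g -> l2sq g = (dot g g)%:E.
Proof.
move=> sg; rewrite /dot /l2dot fineK.
  by rewrite /l2sq; apply: eq_integral => x _; rewrite expr2.
exact: (integrable_fin_num measurable_circle (square_integrableM sg sg)).
Qed.

Lemma orthonormal_square_integrable (D : nat) (phi : 'I_D -> R -> R) :
  orthonormal_fam phi -> forall l, square_integrable (phi l).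
Proof.
move=> [mphi on] l; split; first exact: mphi.
have := on l l; rewrite eqxx /l2dot /l2sq => e.
by under eq_integral do rewrite expr2; rewrite e ltry.
Qed.

(** Pythagoras: the expansion minus [g] is a vector [v] of the span minus the residual [u] of the
    projection, which is orthogonal to the span. The coefficients [b] are arbitrary, so that the
    identity applies to the random ones at each fixed outcome. *)
Lemma l2sq_expansion_error (D : nat) (phi : 'I_D -> R -> R) (g : R -> R)
    (b : 'I_D -> R) : orthonormal_fam phi -> square_integrable g ->
  l2sq (fun x => \sum_(l < D) b l * phi l x - g x) =
  (l2sq (fun x => g x - l2proj phi g x)%R +
   (\sum_(l < D) (b l - dot g (phi l)) ^+ 2)%:E)%E.
Proof.
move=> on sg; have sphi := orthonormal_square_integrable on.
have dphi l k : dot (phi l) (phi k) = (l == k)%:R by rewrite /dot on.2.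
have delta (c : 'I_D -> R) k : \sum_(l < D) c l * dot (phi l) (phi k) = c k.
  rewrite (bigD1 k)//= dphi eqxx mulr1 big1 ?addr0// => l lk.
  by rewrite dphi (negbTE lk) mulr0.
pose a l := dot g (phi l).
pose c l := b l - a l.
pose v x := \sum_(l < D) c l * phi l x.
(* Subtraction is written as adding a multiple by -1 so that [dotDl] and [dotZl] apply directly. *)
pose u x := g x + (-1) * (\sum_(l < D) a l * phi l x).
have sa : square_integrable (fun x => \sum_(l < D) a l * phi l x).
  exact: square_integrable_sum.
have su : square_integrable u.
  by apply: square_integrableD => //; exact: square_integrableZ.
have sv : square_integrable v by exact: square_integrable_sum.
have sNu : square_integrable (fun x => -1 * u x) by exact: square_integrableZ.
have duphi k : dot u (phi k) = 0.
  rewrite dotDl//; last exact: square_integrableZ.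
  by rewrite dotZl// dot_suml// delta /a; ring.
have dvu : dot v u = 0.
  by rewrite dot_suml// big1// => l _; rewrite dotC duphi mulr0.
have dvv : dot v v = \sum_(l < D) c l ^+ 2.
  rewrite dot_suml//; apply: eq_bigr => l _.
  by rewrite dotC dot_suml// delta expr2.
rewrite (_ : (fun x => _ - g x) = (fun x => v x + (-1) * u x)); last first.
  apply/funext => x; rewrite /v /u.
  under [X in _ = X + _]eq_bigr do rewrite mulrBl.
  by rewrite sumrB; ring.
rewrite (_ : (fun x => g x - _) = u); last first.
  by apply/funext => x; rewrite /u mulN1r.
set w := (fun x => v x + -1 * u x).
have sw : square_integrable w by exact: square_integrableD.
have wh h : square_integrable h -> dot w h = dot v h - dot u h.
  by move=> sh; rewrite dotDl// dotZl// mulN1r.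
rewrite !l2sq_dot// -EFinD; congr EFin.
by rewrite wh// (dotC v) (dotC u) !wh// (dotC u v) dvu dvv; ring.
Qed.

End circle_L2.

(** * Consequences of having a density *)

Section density.
Context {R : realType} {d : measure_display} {Omega : measurableType d}.
Variables (P : probability Omega R) (X : Omega -> R) (f : R -> R).
Local Notation mu := (@lebesgue_measure R).
Local Notation TR := (measurableTypeR R).
Hypothesis mX : measurable_fun setT (X : Omega -> TR).
Hypothesis sf : square_integrable f.
Hypothesis densX : forall A : set R, measurable A ->
  P [set w | A (X w)] = (\int[mu]_(x in A `&` circle) (f x)%:E)%E.

Lemma square_integrable_integrable (g : R -> R) : square_integrable g ->
  mu.-integrable circle (EFin \o g).
Proof.
move=> sg; have s1 : square_integrable (fun=> 1 : R).
  split; first exact: measurable_cst.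
  rewrite /l2sq expr1n integral_cst ?mul1e; last exact: measurable_circle.
  by rewrite [ltLHS]lebesgue_measure_circle ltry.
have := square_integrableM sg s1.
by congr (integrable _ _ _); apply/funext => x /=; rewrite mulr1.
Qed.

(** The law of [X] is dominated by Lebesgue measure, so the Radon-Nikodym change of variables
    applies; it remains to identify the derivative with [f] extended by zero. *)
Lemma density_Rintegral (h : R -> R) (M : R) :
  measurable_fun setT (h : TR -> R) -> (forall x, `|h x| <= M) ->
  \int[P]_w h (X w) = dot h f.
Proof.
move=> mh hM.
pose X' : {RV P >-> TR} := HB.pack X (isMeasurableFun.Build _ _ _ _ (X : Omega -> TR) mX).
pose nu := distribution P X'.
have nuE (A : set TR) : measurable A -> nu A = (\int[mu]_(x in A `&` circle) (f x)%:E)%E.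
  exact: densX.
have mf : measurable_fun (circle : set TR) (EFin \o f).
  by apply/measurable_EFinP; exact: sf.1.
have numu : nu `<< mu.
  apply/null_content_dominatesP => A mA A0; rewrite nuE//.
  apply: null_set_integral.
  - by apply: measurableI => //; exact: measurable_circle.
  - by apply: measurable_funS mf => //; exact: measurable_circle.
  - by apply: (subset_measure0 _ mA _ A0) => //;
      apply: measurableI => //; exact: measurable_circle.
pose ft : TR -> \bar R := (EFin \o f) \_ circle.
have ift : mu.-integrable setT ft.
  apply: (integrable_mkcond _ measurable_circle).1.
  exact: square_integrable_integrable.
pose r := Radon_Nikodym (charge_of_finite_measure nu) mu.
have mr : measurable_fun setT r.
  by apply: measurable_int; exact: Radon_Nikodym_integrable.
(* Both functions have the same integral over every measurable set. *)
have rf : ae_eq mu setT ft r.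
  apply: integral_ae_eq => //.
  move=> A _ mA; rewrite -Radon_Nikodym_integral//.
  by rewrite [RHS]nuE// integral_mkcondr.
have ih : nu.-integrable setT (EFin \o h).
  exact: (@bounded_integrableP _ _ _ nu h M).
rewrite /dot /Rintegral; congr fine.
transitivity (\int[nu]_x (h x)%:E)%E.
  rewrite (@integral_distribution _ _ _ _ _ P X' (EFin \o h))//.
    exact/measurable_EFinP.
  apply: (@bounded_integrableP _ _ _ P _ M) => //.
  exact: measurableT_comp.
rewrite -(Radon_Nikodym_change_of_variables numu measurableT ih).
transitivity (\int[mu]_x ((h x)%:E * ft x))%E; last first.
  rewrite /l2dot [RHS]integral_mkcond; apply: eq_integral => x _.
  by rewrite /ft !patchE; case: ifPn => _ //; rewrite mule0.
apply: ae_eq_integral => //.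
- by apply: emeasurable_funM => //; exact/measurable_EFinP.
- apply: emeasurable_funM; first exact/measurable_EFinP.
  exact: measurable_int ift.
- apply: ae_eqe_mul2l; exact: ae_eq_sym.
Qed.

(** Over the set where f < 0 the integral of [f] is a probability, hence nonnegative, while its
    integrand is negative. So the integral of |f| vanishes there and the set is null. *)
Lemma density_ae_ge0 : {ae mu, forall x, circle x -> 0 <= f x}.
Proof.
have mf : measurable_fun (circle : set TR) (EFin \o f).
  by apply/measurable_EFinP; exact: sf.1.
pose A : set TR := circle `&` [set x | f x < 0].
have mA : measurable A.
  rewrite (_ : A = circle `&` f @^-1` `]-oo, 0[%classic).
    by apply: sf.1 => //; exact: measurable_circle.
  by apply/seteqP; split=> x [cx fx]; split=> //; move: fx; rewrite /= in_itv.
have mfA : measurable_fun A (EFin \o f).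
  by apply: (measurable_funS measurable_circle _ mf) => x [].
have H := densX mA.
have AA : A `&` circle = A by apply/seteqP; split=> [x []|x [? ?]].
rewrite AA in H.
have I0 : (0 <= \int[mu]_(x in A) (f x)%:E)%E by rewrite -H.
have : (\int[mu]_(x in A) `|(EFin \o f) x| = 0)%E.
  apply/eqP; rewrite eq_le; apply/andP; split; last exact: integral_ge0.
  rewrite -oppe_ge0 -integral_ge0N//.
  apply: (le_trans I0); rewrite le_eqVlt; apply/orP; left; apply/eqP.
  apply: eq_integral => x; rewrite inE => -[_ fx0].
  by rewrite /= ler0_norm ?opprK// ltW.
move=> /ae_eq_integral_abs => /(_ mA mfA).
apply: filterS => x /= Ax cx; rewrite leNgt; apply/negP => fx0.
have [] := Ax (conj cx fx0).
by move=> fx; move: fx0; rewrite fx ltxx.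
Qed.

End density.

(** * Measurability of arcs and pointwise inequalities *)

Section pointwise.
Context {R : realType}.

Lemma measurable_arcb (d : measure_display) (T : measurableType d)
    (a b c : T -> R) : measurable_fun setT a -> measurable_fun setT b ->
  measurable_fun setT c -> measurable_fun setT (fun t => arcb (a t) (b t) (c t)).
Proof.
move=> ma mb mc; apply: measurable_fun_ifT.
- exact: measurable_fun_ler.
- by apply: measurable_and; exact: measurable_fun_ler.
- apply: measurable_or; apply: measurable_and.
  + exact: measurable_fun_ler.
  + exact: measurable_fun_ltr.
  + exact: measurable_fun_ler.
  + exact: measurable_fun_ler.
Qed.

Lemma measurable_natr_bool (d : measure_display) (T : measurableType d)
    (b : T -> bool) : measurable_fun setT b ->
  measurable_fun setT (fun t => (b t)%:R : R).
Proof.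
move=> mb; rewrite (_ : (fun t => _) = (fun t => if b t then 1 else 0)).
  by apply: measurable_fun_ifT => //; exact: measurable_cst.
by apply/funext => t; case: (b t).
Qed.

(** With t the truncated denominator, y'/t - f = ((y' - f sg) - f (t - sg)) / t and t >= s0/2.
    Taking the positive part brings y no farther from the nonnegative number f sg. *)
Lemma truncated_ratio_error_good (s0 K y s sg f : R) : 0 < s0 -> 0 <= f ->
  0 <= sg -> 0 <= K -> s0 / 2 <= s ->
  (Num.max y 0 / Num.max s K - f) ^+ 2 <=
  8 / s0 ^+ 2 * (y - f * sg) ^+ 2 +
  8 / s0 ^+ 2 * (f ^+ 2 * (2 * (s - sg) ^+ 2 + 2 * K ^+ 2)).
Proof.
move=> s00 f0 sg0 K0 ss; set y' := Num.max y 0; set t := Num.max s K.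
have fsg0 : 0 <= f * sg by rewrite mulr_ge0.
have ts : s0 / 2 <= t by rewrite le_max ss.
have t0 : 0 < t by rewrite (lt_le_trans _ ts)// divr_gt0.
have yy : (y' - f * sg) ^+ 2 <= (y - f * sg) ^+ 2.
  rewrite /y'; case: (leP y 0) => // y0.
  rewrite sub0r sqrrN -[leRHS]sqrrN ler_pXn2r ?nnegrE//; lra.
have tt : (t - sg) ^+ 2 <= 2 * (s - sg) ^+ 2 + 2 * K ^+ 2.
  (* Truncation acts only when s <= K, and then moves the denominator by K - s, which lies between 0
     and K since s >= 0. *)
  rewrite /t; case: (leP s K) => sK; last first.
    by have := sqr_ge0 (s - sg); have := sqr_ge0 K; lra.
  rewrite (_ : K - sg = (s - sg) + (K - s)); last by ring.
  have h1 : (K - s) ^+ 2 <= K ^+ 2.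
    have s_ge0 : 0 <= s by rewrite (le_trans _ ss)// divr_ge0// ltW.
    by rewrite ler_pXn2r ?nnegrE//; lra.
  have := sqr_ge0 ((s - sg) - (K - s)); nra.
have ti : t^-1 ^+ 2 <= 4 / s0 ^+ 2.
  have -> : 4 / s0 ^+ 2 = (s0 / 2)^-1 ^+ 2 by field; rewrite gt_eqF.
  have it0 : 0 <= t^-1 by rewrite invr_ge0 ltW.
  have its : t^-1 <= (s0 / 2)^-1 by rewrite lef_pV2 ?posrE// divr_gt0.
  by rewrite ler_pXn2r ?nnegrE//; exact: le_trans its.
have -> : y' / t - f = (y' - f * sg - f * (t - sg)) * t^-1.
  by field; rewrite gt_eqF.
rewrite exprMn.
have h2 : (y' - f * sg - f * (t - sg)) ^+ 2 <=
    2 * (y - f * sg) ^+ 2 + 2 * (f ^+ 2 * (2 * (s - sg) ^+ 2 + 2 * K ^+ 2)).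
  have := ler_wpM2l (sqr_ge0 f) tt.
  have := sqr_ge0 ((y' - f * sg) + f * (t - sg)).
  nra.
apply: (le_trans (ler_pM (sqr_ge0 _) (sqr_ge0 _) h2 ti)).
by rewrite le_eqVlt; apply/orP; left; apply/eqP; field; rewrite gt_eqF.
Qed.

(** With no control on [s], the denominator is still at least [K] and the numerator at most [B]. *)
Lemma truncated_ratio_error_bad (B y s K f : R) : 0 < K -> 0 <= B ->
  y <= B ->
  (Num.max y 0 / Num.max s K - f) ^+ 2 <= 2 * (B / K) ^+ 2 + 2 * f ^+ 2.
Proof.
move=> K0 B0 yB; set t := Num.max s K.
have Kt : K <= t by rewrite le_max lexx orbT.
have t0 : 0 < t by exact: lt_le_trans Kt.
have y0 : 0 <= Num.max y 0 by rewrite le_max lexx orbT.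
have h : (Num.max y 0 / t) ^+ 2 <= (B / K) ^+ 2.
  have it0 : 0 <= t^-1 by rewrite invr_ge0 ltW.
  have le_yt : Num.max y 0 / t <= B / K.
    apply: ler_pM => //; first by rewrite ge_max yB.
    by rewrite lef_pV2 ?posrE.
  have yt0 : 0 <= Num.max y 0 / t by exact: mulr_ge0.
  by rewrite ler_pXn2r ?nnegrE//; exact: le_trans le_yt.
have := sqr_ge0 (Num.max y 0 / t + f); nra.
Qed.

(** Bounds the kernel of the projection, the sum of phi_l(x) phi_l(y), by its bound on the
    diagonal. *)
Lemma sum_prod_le (D : nat) (a b : 'I_D -> R) (M : R) :
  \sum_(l < D) a l ^+ 2 <= M -> \sum_(l < D) b l ^+ 2 <= M ->
  \sum_(l < D) a l * b l <= M.
Proof.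
move=> aM bM.
suff : \sum_(l < D) a l * b l <= \sum_(l < D) (a l ^+ 2 / 2 + b l ^+ 2 / 2).
  by rewrite big_split/= -!mulr_suml; lra.
apply: ler_sum => l _; have := sqr_ge0 (a l - b l); nra.
Qed.

(** With q = c n / 4 one has q <= exp(q), and the fourth power of the inverses is the claim. The
    exponent 4 turns the n^3 paid at bad points into 1/n. *)
Lemma poly_expR_bound (c : R) (n : nat) : 0 < c -> (0 < n)%N ->
  expR (- c * n%:R) <= (4 / c) ^+ 4 / n%:R ^+ 4.
Proof.
move=> c0 n0; have nR : 0 < n%:R :> R by rewrite ltr0n.
have q0 : 0 < c * n%:R / 4 by rewrite divr_gt0// mulr_gt0.
have -> : - c * n%:R = (- (c * n%:R / 4)) * 4%:R by lra.
rewrite expRM_natr expRN.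
have -> : (4 / c) ^+ 4 / n%:R ^+ 4 = (c * n%:R / 4)^-1 ^+ 4.
  by field; rewrite !gt_eqF.
have ei0 : 0 <= (expR (c * n%:R / 4))^-1 by rewrite invr_ge0 expR_ge0.
suff ei : (expR (c * n%:R / 4))^-1 <= (c * n%:R / 4)^-1.
  by rewrite ler_pXn2r ?nnegrE//; exact: le_trans ei.
rewrite lef_pV2 ?posrE ?expR_gt0//.
by apply: le_trans (expR_ge1Dx _); lra.
Qed.

End pointwise.

(** The integral of a nonnegative function is a supremum over simple functions below it, hence
    monotone without measurability. This allows bounding the expected loss without proving the loss
    measurable in the outcome. *)
Lemma ge0_le_integral_nonmeasurable (d : measure_display) (T : measurableType d)
    (R : realType) (m : {measure set T -> \bar R}) (f g : T -> \bar R) :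
  (forall x, (0 <= f x)%E) -> (forall x, (f x <= g x)%E) ->
  (\int[m]_x f x <= \int[m]_x g x)%E.
Proof.
move=> f0 fg; rewrite !ge0_integralTE// => [|x]; last exact: le_trans (fg x).
apply: le_ereal_sup => _ [h hf <-]; exists h => // x.
exact: le_trans (fg x).
Qed.

Lemma measurable_fun_invr_gt0 (d : measure_display) (T : measurableType d)
    (R : realType) (A : set T) (t : T -> R) :
  (forall x, 0 < t x) -> measurable_fun A t ->
  measurable_fun A (fun x => (t x)^-1).
Proof.
move=> t0 mt; rewrite (_ : (fun x => _) = (fun x => t x `^ (-1))).
  exact: (measurableT_comp (measurable_powR (-1))).
by apply/funext => x; rewrite powR_inv1// ltW.
Qed.

(** * The censored sample and its coverage frequencies *)

Section censored_sample.
Context {R : realType} {d : measure_display} {Omega : measurableType d}.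
Variables (P : probability Omega R) (X L U : Omega -> R).
Variables (n : nat) (Xs Ls Us : 'I_n -> Omega -> R).
Hypothesis n0 : (0 < n)%N.
Hypotheses (mX : measurable_fun setT X) (mL : measurable_fun setT L)
  (mU : measurable_fun setT U).
Hypothesis mS : forall i, measurable_fun setT (Xs i) /\
  measurable_fun setT (Ls i) /\ measurable_fun setT (Us i).
Hypothesis cS : forall i w, circle (Xs i w).
Hypothesis indepXLU : forall A1 A2 A3 : set R,
  measurable A1 -> measurable A2 -> measurable A3 ->
  P [set w | A1 (X w) /\ A2 (L w) /\ A3 (U w)] =
  (P [set w | A1 (X w)] * P [set w | A2 (L w) /\ A3 (U w)])%E.
Hypothesis identS : forall i (A1 A2 A3 : set R),
  measurable A1 -> measurable A2 -> measurable A3 ->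
  P [set w | A1 (Xs i w) /\ A2 (Ls i w) /\ A3 (Us i w)] =
  P [set w | A1 (X w) /\ A2 (L w) /\ A3 (U w)].
Hypothesis indepS : forall A1 A2 A3 : 'I_n -> set R,
  (forall i, measurable (A1 i) /\ measurable (A2 i) /\ measurable (A3 i)) ->
  P [set w | forall i, A1 i (Xs i w) /\ A2 i (Ls i w) /\ A3 i (Us i w)] =
  (\prod_(i < n) P [set w | A1 i (Xs i w) /\ A2 i (Ls i w) /\ A3 i (Us i w)])%E.
Local Notation mu := (@lebesgue_measure R).
Local Notation TR := (measurableTypeR R).
Local Notation E := (R * (R * R))%type.

Let T i w : E := (Xs i w, (Ls i w, Us i w)).
Let T0 w : E := (X w, (L w, U w)).

Let mT i : measurable_fun setT (T i).
Proof.
by have [? [? ?]] := mS i; do 2 apply: measurable_fun_pair => //.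
Qed.

Let mT0 : measurable_fun setT T0.
Proof. by do 2 apply: measurable_fun_pair => //. Qed.

Let mLU : measurable_fun setT (fun w => (L w, U w)).
Proof. exact: measurable_fun_pair. Qed.

Let ident i (B : set E) : measurable B ->
  P [set w | B (T i w)] = P [set w | B (T0 w)].
Proof.
move=> mB.
apply: (@box_measure_unique R _ _ _ R R R (image_measure P (mT i)) (image_measure P mT0)) => //.
  exact: probability_lty.
by move=> A1 A2 A3 *; exact: identS.
Qed.

Let indep (B : 'I_n -> set E) : (forall i, measurable (B i)) ->
  P [set w | forall i, B i (T i w)] = (\prod_(i < n) P [set w | B i (T i w)])%E.
Proof.
pose G : set (set E) := [set C | exists A1 A2 A3 : set R, [/\ measurable A1,
  measurable A2, measurable A3 & C = A1 `*` (A2 `*` A3)]].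
apply: (@independence_extend _ _ _ P _ E G).
- move=> _ [A1 [A2 [A3 [m1 m2 m3 ->]]]].
  by apply: measurableX => //; exact: measurableX.
- move=> m1 m2 m1oo m12; apply: box_measure_unique => // A1 A2 A3 *.
  by apply: m12; exists A1, A2, A3.
- exact: mT.
- move=> C GC.
  have [A1 A1P] := choice GC; have [A2 A2P] := choice A1P.
  have [A3 A3P] := choice A2P.
  have CE : C = fun i => A1 i `*` (A2 i `*` A3 i).
    by apply/funext => i; have [] := A3P i.
  by rewrite CE; apply: indepS => i; have [] := A3P i.
Qed.

(** For fixed [A] both sides are finite measures in [B], and they agree on rectangles by
    [indepXLU]. *)
Lemma X_independent_of_LU (A : set R) (B : set (R * R)) :
  measurable A -> measurable B ->
  P [set w | A (X w) /\ B (L w, U w)] =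
  (P [set w | A (X w)] * P [set w | B (L w, U w)])%E.
Proof.
move=> mA mB.
have mXA : measurable [set w | A (X w)].
  by rewrite -[X in measurable X]setTI; exact: mX.
have pfin : P [set w | A (X w)] \is a fin_num by exact: fin_num_measure.
have p0 : (0 <= fine (P [set w | A (X w)]))%R by exact: fine_ge0.
pose m1 := image_measure (mrestr P mXA) mLU.
pose m2 : {measure set (R * R) -> \bar R} :=
  mscale (NngNum p0) (image_measure P mLU).
have m1E C : m1 C = P [set w | A (X w) /\ C (L w, U w)].
  rewrite /m1 image_measureE /mrestr; congr (P _).
  by apply/seteqP; split=> w [].
have m2E C : m2 C = (P [set w | A (X w)] * P [set w | C (L w, U w)])%E.
  by rewrite -[X in _ = (X * _)%E](fineK pfin).
rewrite -m1E -m2E; apply: rectangle_measure_unique mB.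
  rewrite m1E; apply: (@le_lt_trans _ _ (P setT)); last exact: probability_lty.
  by apply: le_measure; rewrite ?inE// (_ : mkset _ = [set w | A (X w)])//;
    apply/seteqP; split=> w // [].
by move=> A2 A3 mA2 mA3; rewrite m1E m2E; exact: indepXLU.
Qed.

(** Makes [sigma_hat] at a fixed point an empirical frequency of the triples, to which the
    mean-square and Chernoff bounds apply. *)
Let arcs (x : R) : set E := [set e | arcb e.2.1 e.2.2 x].

Let measurable_arcs x : measurable (arcs x).
Proof.
apply: measurable_bool_set; apply: measurable_arcb => //.
- by apply: measurableT_comp => //; exact: measurable_snd.
- by apply: measurableT_comp => //; exact: measurable_snd.
Qed.

Let sigma_hatE w x :
  sigma_hat Ls Us w x = n%:R^-1 * \sum_(i < n) \1_(arcs x) (T i w).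
Proof.
congr (_ * _); apply: eq_bigr => i _; rewrite indicE /arcs.
by rewrite (_ : (_ \in _) = arcb (Ls i w) (Us i w) x)//; apply/idP/idP; rewrite inE.
Qed.

Let mP0 x : measurable [set w | arcs x (T0 w)].
Proof. by rewrite -[X in measurable X]setTI; exact: mT0. Qed.

Lemma sigmaf_bounds x : 0 <= sigmaf P L U x <= 1.
Proof.
rewrite fine_ge0//= -lee_fin fineK ?probability_le1//; first exact: (mP0 x).
exact: (fin_num_measure P _ (mP0 x)).
Qed.

Lemma sigmaf_Rintegral x :
  sigmaf P L U x = \int[P]_w (arcb (L w) (U w) x)%:R.
Proof.
rewrite /Rintegral /sigmaf -(setIT [set w | _]) -integral_indic//.
  by congr fine; apply: eq_integral => w _; rewrite indicE mem_setE.
exact: (mP0 x).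
Qed.

Lemma sigma_hat_sq_error x :
  \int[P]_w (sigma_hat Ls Us w x - sigmaf P L U x) ^+ 2 <= n%:R^-1.
Proof.
have mg : measurable_fun setT (\1_(arcs x) : E -> R) by exact: measurable_indic.
have gM e : `|\1_(arcs x) e : R| <= 1.
  by rewrite indicE; case: (_ \in _); rewrite ?normr1 ?normr0.
have := sample_mean_sq_error n0 mT mT0 ident indep mg gM.
have -> : \int[P]_v \1_(arcs x) (T0 v) = sigmaf P L U x.
  rewrite sigmaf_Rintegral; apply: eq_Rintegral => w _.
  by rewrite indicE mem_setE.
under eq_Rintegral do rewrite -sigma_hatE.
move=> /le_trans; apply; rewrite ler_piMr ?invr_ge0//.
rewrite -[leRHS](Rintegral_const P 1); apply: le_Rintegral => //.
- apply: (@bounded_integrableP _ _ _ P _ 1).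
    by apply: measurable_funX; exact: measurableT_comp.
  by move=> w; rewrite normrX exprn_ile1.
- by apply: (@bounded_integrableP _ _ _ P _ 1) => // w; rewrite normr1.
Qed.

Lemma sigma_hat_lower_tail x (s : R) : 0 < s -> s <= sigmaf P L U x ->
  (P [set w | (sigma_hat Ls Us w x < s / 2)%R] <=
   ((4 / (s / 2 * (1 - ln 2))) ^+ 4 / n%:R ^+ 4)%:E)%E.
Proof.
move=> s0 ss.
(* The Chernoff rate is positive because 2 = 1 + 1 < exp(1). *)
have l2 : 0 < 1 - ln 2 :> R.
  rewrite subr_gt0 -ltr_expR lnK ?posrE//.
  by have := @expR_gt1Dx R 1 (oner_neq0 _); lra.
have := sample_frequency_chernoff n0 mT mT0 ident indep (measurable_arcs x) (ltW s0).
rewrite (_ : [set w | _ < s / 2] = [set w | sigma_hat Ls Us w x < s / 2]); last first.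
  by apply/seteqP; split=> w /=; rewrite sigma_hatE.
move=> H; apply: (le_trans (H _)).
  by move: ss; rewrite -lee_fin fineK//; exact: (fin_num_measure P _ (mP0 x)).
by rewrite lee_fin poly_expR_bound// mulr_gt0// divr_gt0.
Qed.

(** As a function of the point, [sigmaf] is a partial integral of a jointly measurable indicator, so
    Tonelli's theorem gives its measurability. *)
Lemma measurable_sigmaf : measurable_fun setT (sigmaf P L U : TR -> R).
Proof.
pose h (p : Omega * TR) : \bar R := ((arcb (L p.1) (U p.1) p.2)%:R)%:E.
have mh : measurable_fun setT h.
  apply/measurable_EFinP; apply: measurable_natr_bool; apply: measurable_arcb.
  - exact: measurableT_comp.
  - exact: measurableT_comp.
  - exact: measurable_snd.
have := measurable_fun_fubini_tonelli_G (m1 := P) h mh.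
move=> /(_ (fun p => _)) mG.
rewrite (_ : sigmaf P L U = fine \o fubini_G P h).
  apply: measurableT_comp; first exact: fine_measurable.
  by apply: mG => p; rewrite lee_fin.
by apply/funext => x; rewrite sigmaf_Rintegral.
Qed.

(** * Empirical coefficients of psi *)

Variables (f : R -> R) (D : nat) (phi : 'I_D -> R -> R) (M : R).
Hypothesis sf : square_integrable f.
Hypothesis densX : forall A : set R, measurable A ->
  P [set w | A (X w)] = (\int[mu]_(x in A `&` circle) (f x)%:E)%E.
Hypothesis mphi : forall l, measurable_fun (circle : set TR) (phi l).
Hypothesis phiM : forall x, circle x -> \sum_(l < D) (phi l x) ^+ 2 <= M.
Hypothesis M0 : 0 <= M.

(** The family [phi] is measurable and bounded on the circle only; extension by zero makes both
    properties global, as the results on samples require. *)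
Let phit l : TR -> R := phi l \_ circle.

Let phitE l x : circle x -> phit l x = phi l x.
Proof. by move=> cx; rewrite /phit patchE mem_set. Qed.

Let mphit l : measurable_fun setT (phit l).
Proof. exact: (measurable_restrictT _ measurable_circle).1. Qed.

Let phit_sum x : \sum_(l < D) phit l x ^+ 2 <= M.
Proof.
have [cx|ncx] := pselect (circle x).
  by under eq_bigr do rewrite phitE//; exact: phiM.
by rewrite big1// => l _; rewrite /phit patchE memNset// expr0n.
Qed.

Let phit_sq l x : phit l x ^+ 2 <= M.
Proof.
apply: le_trans (phit_sum x); rewrite (bigD1 l)//= lerDl.
by apply: sumr_ge0 => k _; exact: sqr_ge0.
Qed.

(** A crude bound without square roots; it serves only to guarantee integrability and never enters
    the final constants. *)
Let phit_bound l x : `|phit l x| <= 1 + M.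
Proof.
have := phit_sq l x; rewrite -(real_normK (num_real (phit l x))).
have := sqr_ge0 (`|phit l x| - 1); have := normr_ge0 (phit l x); nra.
Qed.

Let g l (e : E) : R := (arcb e.2.1 e.2.2 e.1)%:R * phit l e.1.

Let mdelta : measurable_fun setT (fun e : E => (arcb e.2.1 e.2.2 e.1)%:R : R).
Proof.
apply: measurable_natr_bool; apply: measurable_arcb => //.
- by apply: measurableT_comp => //; exact: measurable_snd.
- by apply: measurableT_comp => //; exact: measurable_snd.
Qed.

Let mg l : measurable_fun setT (g l).
Proof.
apply: measurable_funM; first exact: mdelta.
by apply: (measurableT_comp (mphit l)); exact: measurable_fst.
Qed.

Let g_bound l e : `|g l e| <= 1 + M.
Proof.
rewrite /g; case: arcb; first by rewrite mul1r; exact: phit_bound.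
by rewrite mul0r normr0 addr_ge0.
Qed.

Let psi_hat_coefE l w :
  n%:R^-1 * \sum_(i < n) Delta Xs Ls Us i w * phi l (Xprime Xs Ls Us i w) =
  n%:R^-1 * \sum_(i < n) g l (T i w).
Proof.
congr (_ * _); apply: eq_bigr => i _; rewrite /Delta /Xprime /g /=.
(* For a censored observation, the value of [phi l] at [- pi], off the circle, is multiplied by
   0. *)
by case: ifPn => _; rewrite ?mul0r// phitE.
Qed.

(** The empirical coefficients are unbiased: by independence, integrating out (L, U) first turns the
    indicator into sigma(X), and the density of X then gives the inner product with f sigma. *)
Let psi_coefE l :
  \int[P]_w g l (T0 w) = dot (fun x => f x * sigmaf P L U x) (phi l).
Proof.
have mh : measurable_fun setT (fun p : R * (R * R) => g l p) by exact: mg.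
have -> : \int[P]_w g l (T0 w) = \int[P]_w (phit l (X w) * sigmaf P L U (X w)).
  rewrite /Rintegral.
  rewrite (@independence_fubini _ _ _ P _ _ _ _ X (fun w => (L w, U w)) (g l)
    (1 + M) mX mLU X_independent_of_LU mh (g_bound l)).
  congr fine; apply: eq_integral => w _.
  rewrite -EFin_Rintegral; last first.
    apply: (@bounded_integrableP _ _ _ P _ (1 + M)).
      by apply: measurableT_comp => //; exact: measurable_fun_pair.
    by move=> v; exact: g_bound.
  rewrite sigmaf_Rintegral -RintegralZl//.
    by congr EFin; apply: eq_Rintegral => v _; rewrite /g mulrC.
  apply: (@bounded_integrableP _ _ _ P _ 1).
    by apply: measurable_natr_bool; exact: measurable_arcb.
  by move=> v; case: arcb; rewrite ?normr1 ?normr0.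
rewrite (@density_Rintegral _ _ _ P X f mX sf densX
  (fun x => phit l x * sigmaf P L U x) (1 + M)).
- congr fine; apply: eq_integral => x; rewrite inE => cx.
  by rewrite phitE//; congr EFin; ring.
- by apply: measurable_funM => //; exact: measurable_sigmaf.
- move=> x; rewrite normrM -[leRHS]mulr1 ler_pM//.
  by have /andP[s0 s1] := sigmaf_bounds x; rewrite ger0_norm.
Qed.

Let psi := fun x => f x * sigmaf P L U x.
Let bhat l w :=
  n%:R^-1 * \sum_(i < n) Delta Xs Ls Us i w * phi l (Xprime Xs Ls Us i w).

Let bhatE l : bhat l = fun w => n%:R^-1 * \sum_(i < n) g l (T i w).
Proof. by apply/funext => w; exact: psi_hat_coefE. Qed.

Let measurable_bhat l : measurable_fun setT (bhat l).
Proof.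
rewrite bhatE; apply: measurable_funM => //; apply: measurable_sum => i.
exact: measurableT_comp.
Qed.

Let bhat_sq_integrable l :
  P.-integrable setT (EFin \o (fun w => (bhat l w - dot psi (phi l)) ^+ 2)).
Proof.
apply: (@bounded_integrableP _ _ _ P _
    ((n%:R^-1 * (\sum_(i < n) (1 + M)) + `|dot psi (phi l)|) ^+ 2)).
  by apply: measurable_funX; exact: measurable_funB.
move=> w; rewrite normrX lerXn2r ?nnegrE//.
  rewrite addr_ge0// mulr_ge0 ?invr_ge0// sumr_ge0// => i _.
  by rewrite addr_ge0.
rewrite bhatE.
apply: (le_trans (ler_normB _ _)); rewrite lerD2r normrM ger0_norm ?invr_ge0//.
rewrite ler_wpM2l ?invr_ge0//; apply: (le_trans (ler_norm_sum _ _ _)).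
by apply: ler_sum => i _; exact: g_bound.
Qed.

(** Summed over [l], the squares of the [g l] equal the indicator times the sum of phi_l(X)^2, hence
    at most [M] times the indicator. Equality of laws permits any index [i0]. *)
Let psi_hat_coef_sq_error i0 :
  (\int[P]_w (\sum_(l < D) (bhat l w - dot psi (phi l)) ^+ 2)%:E <=
  (M / n%:R)%:E * \int[P]_w (Delta Xs Ls Us i0 w)%:E)%E.
Proof.
have iDelta : P.-integrable setT (EFin \o Delta Xs Ls Us i0).
  have [? [? ?]] := mS i0; apply: (@bounded_integrableP _ _ _ P _ 1).
    by apply: measurable_natr_bool; exact: measurable_arcb.
  by move=> w; rewrite /Delta; case: arcb; rewrite ?normr1 ?normr0.
rewrite -(EFin_Rintegral iDelta) -EFin_Rintegral; last first.
  rewrite (_ : _ \o _ = (fun w => \sum_(l < D) ((bhat l w - dot psi (phi l)) ^+ 2)%:E)%E).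
    by apply: integrable_sum => //= l _; exact: bhat_sq_integrable.
  by apply/funext => w /=; rewrite sumEFin.
rewrite -EFinM lee_fin.
have ig2 l : P.-integrable setT (EFin \o (fun w => g l (T0 w) ^+ 2)).
  apply: (@bounded_integrableP _ _ _ P _ ((1 + M) ^+ 2)).
    by apply: measurable_funX; exact: measurableT_comp.
  by move=> w; rewrite normrX lerXn2r ?nnegrE// addr_ge0.
have -> : \int[P]_w Delta Xs Ls Us i0 w = \int[P]_w (arcb (L w) (U w) (X w))%:R.
  apply: (ident_Rintegral (mT i0) mT0 (@ident i0) mdelta (M := 1)) => e.
  by case: arcb; rewrite ?normr1 ?normr0.
rewrite Rintegral_sum; last exact: bhat_sq_integrable.
apply: (@le_trans _ _ (\sum_(l < D) n%:R^-1 * \int[P]_w (g l (T0 w)) ^+ 2)).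
  apply: ler_sum => l _; rewrite -psi_coefE bhatE.
  exact: (sample_mean_sq_error n0 mT mT0 ident indep (mg l) (g_bound l)).
rewrite -mulr_sumr -Rintegral_sum// [M / _]mulrC -mulrA.
rewrite ler_wpM2l ?invr_ge0//.
have idelta : P.-integrable setT (EFin \o (fun w => (arcb (L w) (U w) (X w))%:R)).
  apply: (@bounded_integrableP _ _ _ P _ 1).
    by apply: measurable_natr_bool; exact: measurable_arcb.
  by move=> w; case: arcb; rewrite ?normr1 ?normr0.
rewrite -RintegralZl//; apply: le_Rintegral => //.
- rewrite (_ : _ \o _ = (fun w => \sum_(l < D) (g l (T0 w) ^+ 2)%:E)%E).
    by apply: integrable_sum => //= l _; exact: ig2.
  by apply/funext => w /=; rewrite sumEFin.
- apply: (@bounded_integrableP _ _ _ P _ M).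
    apply: measurable_funM => //.
    by apply: measurable_natr_bool; exact: measurable_arcb.
  move=> w; case: arcb; rewrite ?mulr1 ?mulr0 ?normr0//.
  by rewrite ger0_norm.
move=> w _; rewrite /g /=; case: arcb.
  by under eq_bigr do rewrite mul1r; rewrite mulr1.
by rewrite mulr0 big1// => l _; rewrite mul0r expr0n.
Qed.

(** Exchanging sums writes [psi_hat] as an average over [i] of kernel values, each at most [M] or
    zero. An upper bound suffices because only the positive part enters [f_hat]. *)
Lemma psi_hat_le w x : circle x -> psi_hat Xs Ls Us phi w x <= M.
Proof.
move=> cx; rewrite /psi_hat.
under eq_bigr do rewrite psi_hat_coefE.
rewrite (_ : \sum_(l < D) _ = n%:R^-1 * \sum_(i < n) \sum_(l < D) g l (T i w) * phi l x).
  rewrite ler_pdivrMl ?ltr0n//.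
  rewrite mulr_natl -[X in _ *+ X]card_ord -sumr_const.
  apply: ler_sum => i _; apply: sum_prod_le; last exact: phiM.
  rewrite /g /=; case: arcb.
    by under eq_bigr do rewrite mul1r; exact: phit_sum.
  by rewrite big1// => l _; rewrite mul0r expr0n.
rewrite exchange_big/= mulr_sumr; apply: eq_bigr => l _.
by rewrite -mulrA mulr_suml.
Qed.

Let sigma_hat_bounds w x : 0 <= sigma_hat Ls Us w x <= 1.
Proof.
have nR : 0 < n%:R :> R by rewrite ltr0n.
apply/andP; split.
  by rewrite mulr_ge0 ?invr_ge0// sumr_ge0.
rewrite ler_pdivrMl// mulr1 -[X in _ <= _ *+ X]card_ord -sumr_const.
by apply: ler_sum => i _; case: arcb.
Qed.

Let measurable_sigma_hat :
  measurable_fun setT (fun p : Omega * TR => sigma_hat Ls Us p.1 p.2).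
Proof.
apply: measurable_funM => //; apply: measurable_sum => i.
have [_ [? ?]] := mS i.
apply: measurable_natr_bool; apply: measurable_arcb.
- exact: measurableT_comp.
- exact: measurableT_comp.
- exact: measurable_snd.
Qed.

Let measurable_sigma_hatx w :
  measurable_fun setT (fun x : TR => sigma_hat Ls Us w x).
Proof. exact: (measurable_fun_pair2 w measurable_sigma_hat). Qed.

Let measurable_sigma_hatw x :
  measurable_fun setT (fun w => sigma_hat Ls Us w x).
Proof. exact: (measurable_fun_pair1 (x : TR) measurable_sigma_hat). Qed.

(** * Majorant of the loss and its expectation *)

Variables (s0 normf Q : R).
Hypothesis s00 : 0 < s0.
Hypothesis sigma_ge : forall x, circle x -> s0 <= sigmaf P L U x.
Hypothesis normfE : l2sq f = (normf ^+ 2)%:E.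
Hypothesis MQ : M <= Q * n%:R.
Hypothesis on : orthonormal_fam phi.

Let A := 8 / s0 ^+ 2.
Let K := (Num.sqrt (n%:R : R))^-1.
Let bad (w : Omega) (x : R) : R := (sigma_hat Ls Us w x < s0 / 2)%R%:R.
(** Collects what the two pointwise bounds leave besides the error of [psi_hat]. Only the second
    summand carries an indicator: the first is nonnegative, so the sum dominates in both cases. *)
Let H w x := A * (f x ^+ 2 * (2 * (sigma_hat Ls Us w x - sigmaf P L U x) ^+ 2
    + 2 * K ^+ 2)) + bad w x * (2 * (M / K) ^+ 2 + 2 * f x ^+ 2).

Let A0 : 0 <= A. Proof. by rewrite divr_ge0// sqr_ge0. Qed.
Let K0 : 0 < K. Proof. by rewrite invr_gt0 sqrtr_gt0 ltr0n. Qed.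
Let K2 : K ^+ 2 = n%:R^-1. Proof. by rewrite exprVn sqr_sqrtr. Qed.
Let H0 w x : 0 <= H w x.
Proof.
have S2 (r t : R) : 0 <= 2 * r ^+ 2 + 2 * t ^+ 2.
  by rewrite addr_ge0// mulr_ge0// sqr_ge0.
apply: addr_ge0; last exact: mulr_ge0.
by apply: mulr_ge0 => //; apply: mulr_ge0; rewrite ?sqr_ge0.
Qed.

Let sq_psi : square_integrable psi.
Proof.
split; first by apply: measurable_funM; [exact: sf.1|
  exact: measurable_funTS measurable_sigmaf].
apply: le_lt_trans sf.2; apply: ge0_le_integral.
- exact: measurable_circle.
- by move=> x _; rewrite lee_fin sqr_ge0.
- apply/measurable_EFinP; apply: measurable_funX.
  by apply: measurable_funM; [exact: sf.1| exact: measurable_funTS measurable_sigmaf].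
- by apply/measurable_EFinP; apply: measurable_funX; exact: sf.1.
- move=> x _; rewrite lee_fin /psi exprMn ler_piMr ?sqr_ge0//.
  by have /andP[? ?] := sigmaf_bounds x; rewrite exprn_ile1.
Qed.

Let measurable_Hx w : measurable_fun (circle : set TR) (H w).
Proof.
have mf2 : measurable_fun (circle : set TR) (fun x => f x ^+ 2).
  by apply: measurable_funX; exact: sf.1.
apply: measurable_funD; apply: measurable_funM => //.
- apply: measurable_funM => //; apply: measurable_funD => //.
  apply: measurable_funM => //; apply: measurable_funX.
  apply: measurable_funTS; apply: measurable_funB => //.
  exact: measurable_sigmaf.
- apply: measurable_funTS; apply: measurable_natr_bool.
  exact: measurable_fun_ltr.
- by apply: measurable_funD => //; exact: measurable_funM.
Qed.

Let measurable_psi_hatx w :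
  measurable_fun (circle : set TR) (psi_hat Xs Ls Us phi w).
Proof.
apply: measurable_sum => l; apply: measurable_funM => //; exact: mphi.
Qed.

Let measurable_f_hatx w :
  measurable_fun (circle : set TR) (f_hat Xs Ls Us phi w).
Proof.
apply: measurable_funM; first exact: measurable_maxr.
apply: measurable_fun_invr_gt0; first by move=> x; rewrite lt_max K0 orbT.
by apply: measurable_maxr => //; exact: measurable_funTS.
Qed.

(** For a fixed outcome the pointwise bounds are integrated over the circle, and Pythagoras splits
    the error of [psi_hat] into bias and coefficient errors. *)
Let slice_error_le w :
  (l2sq (fun x => f_hat Xs Ls Us phi w x - f x)%R <=
   A%:E * (l2sq (fun x => psi x - l2proj phi psi x)%R +
     (\sum_(l < D) (bhat l w - dot psi (phi l)) ^+ 2)%R%:E) +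
   \int[mu]_(x in circle) (H w x)%:E)%E.
Proof.
have mc := @measurable_circle R.
have mpsi2 : measurable_fun (circle : set TR)
    (fun x => (psi_hat Xs Ls Us phi w x - psi x) ^+ 2).
  by apply: measurable_funX; apply: measurable_funB => //; exact: sq_psi.1.
rewrite -l2sq_expansion_error// -ge0_integralZl_EFin//; last 2 first.
- by move=> x _; rewrite lee_fin sqr_ge0.
- exact/measurable_EFinP.
rewrite -ge0_integralD//; last 4 first.
- by move=> x _; rewrite mule_ge0// lee_fin ?sqr_ge0.
- by apply: emeasurable_funM => //; exact/measurable_EFinP.
- by move=> x _; rewrite lee_fin.
- exact/measurable_EFinP.
apply: ae_ge0_le_integral => //.
- by move=> x _; rewrite lee_fin sqr_ge0.
- apply/measurable_EFinP; apply: measurable_funX; apply: measurable_funB => //.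
  exact: sf.1.
- by move=> x _; rewrite adde_ge0// ?mule_ge0// lee_fin// sqr_ge0.
- apply: emeasurable_funD; last exact/measurable_EFinP.
  by apply: emeasurable_funM => //; exact/measurable_EFinP.
(* Points where f < 0 are discarded here, as the bound at good points needs f(x) >= 0. *)
have [N [mN N0 subN]] := density_ae_ge0 sf densX.
exists N; split=> // x nP; apply: subN => /= f0; apply: nP => cx.
rewrite -EFinM -EFinD lee_fin.
have /andP[sg0 _] := sigmaf_bounds x.
have [hbad|hgood] := ltP (sigma_hat Ls Us w x) (s0 / 2).
  apply: (le_trans (truncated_ratio_error_bad _ _ K0 M0 (psi_hat_le w cx))).
  rewrite /H /bad hbad mul1r addrA lerDr.
  have S2 (r t : R) : 0 <= 2 * r ^+ 2 + 2 * t ^+ 2.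
    by rewrite addr_ge0// mulr_ge0// sqr_ge0.
  by apply: addr_ge0; apply: mulr_ge0; rewrite ?sqr_ge0//; apply: mulr_ge0; rewrite ?sqr_ge0.
apply: (le_trans (truncated_ratio_error_good _ s00 (f0 cx) sg0 (ltW K0) hgood)).
by rewrite /H /bad ltNge hgood /= mul0r addr0.
Qed.

Let cK : R := (4 / (s0 / 2 * (1 - ln 2))) ^+ 4.
Let cK0 : 0 <= cK. Proof. exact: exprn_even_ge0. Qed.

Let expected_H_le x : circle x ->
  (\int[P]_w (H w x)%:E <=
   ((4 * A + 2 * cK) / n%:R * f x ^+ 2 + 2 * Q ^+ 2 * cK / n%:R)%:E)%E.
Proof.
move=> cx.
have nR : 1 <= n%:R :> R by rewrite ler1n.
have /andP[sg0 sg1] := sigmaf_bounds x.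
pose V w := (sigma_hat Ls Us w x - sigmaf P L U x) ^+ 2.
have mV : measurable_fun setT V.
  by apply: measurable_funX; exact: measurable_funB.
have V1 w : `|V w| <= 1.
  have /andP[? ?] := sigma_hat_bounds w x.
  by rewrite /V normrX exprn_ile1// ler_norml; lra.
have iV : P.-integrable setT (EFin \o V) by exact: (@bounded_integrableP _ _ _ P _ 1).
have mbad : measurable_fun setT (bad ^~ x).
  by apply: measurable_natr_bool; exact: measurable_fun_ltr.
have bad1 w : `|bad w x| <= 1.
  by rewrite /bad; case: (_ < _); rewrite ?normr1 ?normr0.
have ibad : P.-integrable setT (EFin \o bad ^~ x).
  exact: (@bounded_integrableP _ _ _ P _ 1).
(* At fixed [x], [H] is affine in the two random quantities [V] and [bad]. The terms [c1] and [c2]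
   each contribute 2 A f(x)^2 / n, whence the coefficient 4 A. *)
set c1 := 2 * A * f x ^+ 2; set c2 := 2 * A * f x ^+ 2 * n%:R^-1.
set c3 := 2 * (M / K) ^+ 2 + 2 * f x ^+ 2.
have c10 : 0 <= c1 by rewrite mulr_ge0 ?sqr_ge0// mulr_ge0.
have c30 : 0 <= c3 by rewrite addr_ge0// mulr_ge0// sqr_ge0.
have HE w : H w x = c1 * V w + c2 + c3 * bad w x.
  by rewrite /H K2 /c1 /c2 /c3 /V; ring.
have icV : P.-integrable setT (EFin \o (fun w => c1 * V w)).
  apply: (@bounded_integrableP _ _ _ P _ c1); first exact: measurable_funM.
  by move=> w; rewrite normrM (ger0_norm c10) ler_piMr.
have icb : P.-integrable setT (EFin \o (fun w => c3 * bad w x)).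
  apply: (@bounded_integrableP _ _ _ P _ c3); first exact: measurable_funM.
  by move=> w; rewrite normrM (ger0_norm c30) ler_piMr.
have ic2 : P.-integrable setT (EFin \o (fun=> c2)).
  exact: (@bounded_integrableP _ _ _ P _ `|c2|).
have icVc : P.-integrable setT (EFin \o (fun w => c1 * V w + c2)).
  exact: (integrableD measurableT icV ic2).
under eq_integral do rewrite HE.
rewrite -EFin_Rintegral; last exact: (integrableD measurableT icVc icb).
rewrite RintegralD// RintegralD// RintegralZl// RintegralZl// Rintegral_const lee_fin.
have EV : \int[P]_w V w <= n%:R^-1 by exact: sigma_hat_sq_error.
have Ebad : \int[P]_w bad w x <= cK / n%:R ^+ 4.
  have mb : measurable [set w | (sigma_hat Ls Us w x < s0 / 2)%R].
    by apply: measurable_bool_set; exact: measurable_fun_ltr.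
  have := sigma_hat_lower_tail s00 (sigma_ge cx).
  rewrite -(setIT [set w | _]) -integral_indic//.
  rewrite -lee_fin (EFin_Rintegral ibad); apply: le_trans.
  rewrite le_eqVlt; apply/orP; left; apply/eqP; apply: eq_integral => w _.
  by rewrite indicE mem_setE.
(* Since K^(-2) = n and M <= Q n. *)
have MK : (M / K) ^+ 2 <= Q ^+ 2 * n%:R ^+ 3.
  rewrite exprMn exprVn K2 invrK [n%:R ^+ 3]exprSr mulrA -exprMn.
  rewrite ler_wpM2r ?ler0n// lerXn2r ?nnegrE//.
  exact: le_trans MQ.
have n1 : n%:R^-1 ^+ 3 <= 1 :> R.
  by rewrite exprn_ile1 ?invr_ge0// invf_le1// (lt_le_trans _ nR).
have c3le : c3 * (cK / n%:R ^+ 4) <=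
    2 * cK / n%:R * f x ^+ 2 + 2 * Q ^+ 2 * cK / n%:R.
  have -> : cK / n%:R ^+ 4 = cK * n%:R^-1 * n%:R^-1 ^+ 3.
    by rewrite -exprVn; ring.
  have nn : n%:R * n%:R^-1 = 1 :> R by rewrite mulfV// gt_eqF// (lt_le_trans _ nR).
  have ni0 : 0 <= n%:R^-1 :> R by rewrite invr_ge0.
  have h1 : (M / K) ^+ 2 * n%:R^-1 ^+ 3 <= Q ^+ 2.
    apply: (le_trans (ler_wpM2r (exprn_ge0 3 ni0) MK)).
    by rewrite -mulrA -exprMn nn expr1n mulr1.
  have h2 : f x ^+ 2 * n%:R^-1 ^+ 3 <= f x ^+ 2 by rewrite ler_piMr// sqr_ge0.
  have h3 : 0 <= cK * n%:R^-1 by exact: mulr_ge0.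
  have := ler_wpM2l h3 h1; have := ler_wpM2l h3 h2; rewrite /c3; lra.
have := ler_wpM2l c10 EV; have := ler_wpM2l c30 Ebad; rewrite /c1 /c2.
lra.
Qed.

Let ft : TR -> R := f \_ circle.
(* H extended by 0 outside the circle: jointly measurable on the whole product,
   as required by Tonelli's theorem. *)
Let Ht (p : Omega * TR) : R := \1_(circle : set TR) p.2 *
  (A * (ft p.2 ^+ 2 * (2 * (sigma_hat Ls Us p.1 p.2 - sigmaf P L U p.2) ^+ 2
    + 2 * K ^+ 2)) + bad p.1 p.2 * (2 * (M / K) ^+ 2 + 2 * ft p.2 ^+ 2)).

Let measurable_Ht : measurable_fun setT Ht.
Proof.
have mft2 : measurable_fun setT (fun p : Omega * TR => ft p.2 ^+ 2).
  apply: measurable_funX; apply: (@measurableT_comp _ _ _ _ _ _ ft); last exact: measurable_snd.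
  by apply: (measurable_restrictT _ measurable_circle).1; exact: sf.1.
have mi : measurable_fun setT (\1_(circle : set TR) : TR -> R).
  by apply: measurable_indic; exact: measurable_circle.
apply: measurable_funM; first exact: (measurableT_comp mi measurable_snd).
apply: measurable_funD; apply: measurable_funM => //.
- apply: measurable_funM => //; apply: measurable_funD => //.
  apply: measurable_funM => //; apply: measurable_funX.
  apply: measurable_funB => //.
  exact: (measurableT_comp measurable_sigmaf measurable_snd).
- by apply: measurable_natr_bool; exact: measurable_fun_ltr.
- by apply: measurable_funD => //; exact: measurable_funM.
Qed.

Let HtE w x : (Ht (w, x))%:E = ((fun y => (H w y)%:E) \_ circle) x.
Proof.
rewrite /Ht /H patchE indicE /= /ft patchE; case: ifPn => _.
  by rewrite mul1r.
by rewrite mul0r.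
Qed.

Let Ht0 p : (0 <= (Ht p)%:E)%E.
Proof. by case: p => w x; rewrite HtE patchE; case: ifPn => // _; rewrite lee_fin. Qed.

Let measurable_int_H :
  measurable_fun setT (fun w => \int[mu]_(x in circle) (H w x)%:E)%E.
Proof.
rewrite (_ : (fun w => _) = fubini_F mu (EFin \o Ht)).
  apply: measurable_fun_fubini_tonelli_F => //.
  exact/measurable_EFinP.
apply/funext => w; rewrite integral_mkcond; apply: eq_integral => x _.
by rewrite -HtE.
Qed.

Let expected_int_H_le :
  (\int[P]_w \int[mu]_(x in circle) (H w x)%:E <=
   (((4 * A + 2 * cK) * normf ^+ 2 + 2 * Q ^+ 2 * cK * (2 * pi)) / n%:R)%:E)%E.
Proof.
under eq_integral do rewrite integral_mkcond.
under eq_integral do under eq_integral do rewrite -HtE.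
have mEHt : measurable_fun setT (EFin \o Ht) by exact/measurable_EFinP.
rewrite (fubini_tonelli (m1 := P) (m2 := mu) (EFin \o Ht) mEHt Ht0) /=.
set al := (4 * A + 2 * cK) / n%:R; set be := 2 * Q ^+ 2 * cK / n%:R.
have al0 : 0 <= al by rewrite divr_ge0// addr_ge0// mulr_ge0.
have be0 : 0 <= be by rewrite divr_ge0// mulr_ge0// mulr_ge0// sqr_ge0.
(* After Tonelli the outer integral runs over the whole line, where the integrand vanishes off the
   circle; on it [expected_H_le] applies pointwise, and integrating gives the squared norm of [f]
   and the length 2 pi. *)
apply: (@le_trans _ _ (\int[mu]_(x in circle) (al * f x ^+ 2 + be)%:E)%E).
  rewrite [leRHS]integral_mkcond; apply: ge0_le_integral_nonmeasurable.
    by move=> x; apply: integral_ge0 => w _; exact: Ht0.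
  move=> x; rewrite patchE; case: ifPn => [|xc].
    rewrite inE => cx; rewrite -/al -/be; apply: le_trans (expected_H_le cx).
    rewrite le_eqVlt; apply/orP; left; apply/eqP; apply: eq_integral => w _.
    by rewrite HtE patchE mem_set.
  under eq_integral do rewrite HtE patchE (negbTE xc).
  by rewrite integral0.
have mc := @measurable_circle R.
have mf2 : measurable_fun (circle : set TR) (fun x => (f x ^+ 2)%:E).
  by apply/measurable_EFinP; apply: measurable_funX; exact: sf.1.
under eq_integral do rewrite EFinD EFinM.
rewrite ge0_integralD//; last 2 first.
- by move=> x _; rewrite mule_ge0// lee_fin ?sqr_ge0.
- by apply: emeasurable_funM.
rewrite ge0_integralZl_EFin//; last by move=> x _; rewrite lee_fin sqr_ge0.
rewrite integral_cst// [X in (_ + _ * X)%E]lebesgue_measure_circle.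
rewrite -/(l2sq f) normfE -!EFinM -EFinD lee_fin /al /be; lra.
Qed.

Lemma circular_censoring_risk i0 :
  (\int[P]_w l2sq (fun x => (f_hat Xs Ls Us phi w x - f x)%R) <=
   (8 / s0 ^+ 2)%R%:E *
     (l2sq (fun x => (f x * sigmaf P L U x
                     - l2proj phi (fun y => f y * sigmaf P L U y)%R x)%R)
      + (M / n%:R)%R%:E * \int[P]_w (Delta Xs Ls Us i0 w)%:E)
   + (((4 * (8 / s0 ^+ 2) + 2 * (4 / (s0 / 2 * (1 - ln 2))) ^+ 4) * normf ^+ 2
       + 2 * Q ^+ 2 * (4 / (s0 / 2 * (1 - ln 2))) ^+ 4 * (2 * pi)) / n%:R)%R%:E)%E.
Proof.
have l2ge0 h : (0 <= l2sq h :> \bar R)%E.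
  by apply: integral_ge0 => x _; rewrite lee_fin sqr_ge0.
have mb : measurable_fun setT
    (fun w => (\sum_(l < D) (bhat l w - dot psi (phi l)) ^+ 2)%:E).
  apply/measurable_EFinP; apply: measurable_sum => l.
  by apply: measurable_funX; exact: measurable_funB.
have b0 w : (0 <= (\sum_(l < D) (bhat l w - dot psi (phi l)) ^+ 2)%:E)%E.
  by rewrite lee_fin sumr_ge0// => l _; exact: sqr_ge0.
have iH0 w : (0 <= \int[mu]_(x in circle) (H w x)%:E)%E.
  by apply: integral_ge0 => x _; rewrite lee_fin.
apply: (le_trans (ge0_le_integral_nonmeasurable _ _ slice_error_le)) => [w|]; first exact: l2ge0.
rewrite ge0_integralD//; last 2 first.
- by move=> w _; rewrite mule_ge0// ?lee_fin// adde_ge0.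
- by apply: emeasurable_funM => //; exact: emeasurable_funD.
apply: leeD; last exact: expected_int_H_le.
rewrite ge0_integralZl_EFin//; last 2 first.
- by move=> w _; rewrite adde_ge0.
- exact: emeasurable_funD.
(* The bias term is constant in the outcome, so its expectation is itself as [P] has mass 1. *)
rewrite lee_wpmul2l ?lee_fin// ge0_integralD// integral_cst//.
rewrite [X in (_ * X + _)%E](probability_setT P) mule1.
by rewrite leeD2l//; exact: psi_hat_coef_sq_error.
Qed.

End censored_sample.

Theorem theorem3p1 (R : realType) (Phi0 sigma0 normf : R) :
  0 < Phi0 -> 0 < sigma0 -> 0 <= normf ->
  exists C : R,
  forall (d : measure_display) (Omega : measurableType d)
    (P : probability Omega R)
    (X L U : Omega -> R)
    (n : nat) (hn : (0 < n)%N) (Xs Ls Us : 'I_n -> Omega -> R)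
    (f : R -> R) (D : nat) (phi : 'I_D -> R -> R),
  (* (X, L, U) : S^1-valued random variables *)
  measurable_fun setT X -> measurable_fun setT L -> measurable_fun setT U ->
  (forall w, circle (X w) /\ circle (L w) /\ circle (U w)) ->
  (* the sample (X_i, L_i, U_i), i < n *)
  (forall i, measurable_fun setT (Xs i) /\ measurable_fun setT (Ls i) /\
             measurable_fun setT (Us i)) ->
  (forall i w, circle (Xs i w) /\ circle (Ls i w) /\ circle (Us i w)) ->
  (* L <> U a.s. *)
  P [set w | L w = U w] = 0%E ->
  (* X independent of (L, U) *)
  (forall A1 A2 A3 : set R, measurable A1 -> measurable A2 -> measurable A3 ->
     P [set w | A1 (X w) /\ A2 (L w) /\ A3 (U w)] =
     (P [set w | A1 (X w)] * P [set w | A2 (L w) /\ A3 (U w)])%E) ->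
  (* X has density f *)
  (forall A : set R, measurable A ->
     P [set w | A (X w)] =
     (\int[@lebesgue_measure R]_(x in A `&` circle) (f x)%:E)%E) ->
  (* each (X_i, L_i, U_i) has the law of (X, L, U) *)
  (forall i (A1 A2 A3 : set R), measurable A1 -> measurable A2 -> measurable A3 ->
     P [set w | A1 (Xs i w) /\ A2 (Ls i w) /\ A3 (Us i w)] =
     P [set w | A1 (X w) /\ A2 (L w) /\ A3 (U w)]) ->
  (* the triples (X_i, L_i, U_i) are mutually independent *)
  (forall A1 A2 A3 : 'I_n -> set R,
     (forall i, measurable (A1 i) /\ measurable (A2 i) /\ measurable (A3 i)) ->
     P [set w | forall i, A1 i (Xs i w) /\ A2 i (Ls i w) /\ A3 i (Us i w)] =
     (\prod_(i < n) P [set w | A1 i (Xs i w) /\ A2 i (Ls i w) /\ A3 i (Us i w)])%E) ->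
  (* f in L^2(S^1), with ||f||_2 = normf *)
  measurable_fun circle f -> l2sq f = (normf ^+ 2)%:E ->
  (* Assumption (A) *)
  (forall x, circle x -> sigma0 <= sigmaf P L U x) ->
  (* S_m = span of the orthonormal family phi, dim D_m = D <= n, with the sieve bound *)
  (D <= n)%N -> orthonormal_fam phi ->
  (forall x, circle x -> \sum_(l < D) (phi l x) ^+ 2 <= Phi0 ^+ 2 * D%:R) ->
  (\int[P]_w l2sq (fun x => (f_hat Xs Ls Us phi w x - f x)%R) <=
   (8 / sigma0 ^+ 2)%R%:E *
     (l2sq (fun x => (f x * sigmaf P L U x
                     - l2proj phi (fun y => f y * sigmaf P L U y)%R x)%R)
      + (Phi0 ^+ 2 * D%:R / n%:R)%R%:E
        * \int[P]_w (Delta Xs Ls Us (Ordinal hn) w)%:E)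
   + (C / n%:R)%R%:E)%E.
Proof.
move=> Phi00 s00 nf0; set cK := (4 / (sigma0 / 2 * (1 - ln 2))) ^+ 4.
(* The numerator of [expected_int_H_le] at Q = Phi0^2, an admissible value since M = Phi0^2 D and D
   <= n. *)
exists ((4 * (8 / sigma0 ^+ 2) + 2 * cK) * normf ^+ 2 +
  2 * (Phi0 ^+ 2) ^+ 2 * cK * (2 * pi)).
move=> d Omega P X L U n hn Xs Ls Us f D phi mX mL mU _ mS cS _ indepXLU densX.
move=> identS indepS mf normfE sigma_ge Dn on phiM.
have sf : square_integrable f by split; [exact: mf|rewrite normfE ltry].
have M0 : 0 <= Phi0 ^+ 2 * D%:R by rewrite mulr_ge0// sqr_ge0.
have MQ : Phi0 ^+ 2 * D%:R <= Phi0 ^+ 2 * n%:R.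
  by rewrite ler_wpM2l ?sqr_ge0// ler_nat.
exact: (circular_censoring_risk hn mX mL mU mS (fun i w => (cS i w).1)
  indepXLU identS indepS sf densX on.1 phiM M0 s00 sigma_ge normfE MQ on).
Qed.
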